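(* Let $d\ge1$ and $\sigma>0$ with $1<\sigma d<2$, let $p^*:=\frac{\sigma d}{\sigma d-1}$ and $p^*<p\le\infty$, let $a>0$, and let $Q(\rho)$ be the solution of $$Q''(\rho)+\frac{d-1}{\rho}Q'(\rho)-Q+ia\left(\frac{1}{\sigma}Q+\rho Q'\right)+|Q|^{2\sigma}Q=0,\qquad 0<\rho<\infty,$$ subject to $0\neq Q(0)\in\mathbb{C}$, $Q'(0)=0$. Fix $T_c>0$ and define, for $0\le t<T_c$ and $\mathbf{x}\in\mathbb{R}^d$, $$\psi_Q^{\rm explicit}(t,\mathbf{x})=\frac{1}{L^{1/\sigma}(t)}\,Q(\rho)\,e^{i\tau(t)},\quad r=|\mathbf{x}|,\quad L(t)=\sqrt{2a(T_c-t)},\quad \rho=\frac{r}{L(t)},\quad \tau(t)=\int_0^t\frac{ds}{L^2(s)}=\frac{1}{2a}\log\frac{T_c}{T_c-t}.$$ Then $\psi_Q^{\rm explicit}$ is an explicit solution of the equation $i\psi_t+\Delta\psi+|\psi|^{2\sigma}\psi=0$ on $\mathbb{R}^d$ which becomes singular in $L^p$ as $t\to T_c$, i.e., $\|\psi_Q^{\rm explicit}(t)\|_p<\infty$ for $0\le t<T_c$ and $\|\psi_Q^{\rm explicit}(t)\|_p\to\infty$ as $t\to T_c$.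
   Context: $\Delta=\sum_{j=1}^d\partial_{x_jx_j}$; for radial functions $\Delta Q(\rho)=Q''+\frac{d-1}{\rho}Q'$. $\|\cdot\|_p$ is the $L^p(\mathbb{R}^d)$ norm in $\mathbf{x}$. *)

(* Defs.v *)
From Stdlib Require Import Reals.
From Coquelicot Require Import Coquelicot.
From mathcomp Require Import ssreflect ssrbool eqtype ssrnat fintype bigop.
From mathcomp Require Rstruct all_classical all_reals all_analysis.

Open Scope R_scope.

Module LpImpl.
Import all_classical all_reals all_analysis Rstruct.
Local Open Scope ereal_scope.

Definition upd (y : nat -> R) (m : nat) (s : R) : nat -> R :=
  fun k => if (k == m)%N then s else y k.

(* Iterated Lebesgue integral over the coordinates 0..n-1 of a
   nonnegative \bar R-valued function.  By Tonelli's theorem this is the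
   integral with respect to the n-dimensional Lebesgue measure. *)
Fixpoint iint (n : nat) (F : (nat -> R) -> \bar R) : \bar R :=
  match n with
  | O => F (fun _ => 0%R)
  | S m => \int[lebesgue_measure]_s iint m (fun y => F (upd y m s))
  end.

Definition integral_Rd (d : nat) (f : ('I_d -> R) -> \bar R) : \bar R :=
  iint d (fun y => f (fun j : 'I_d => y (nat_of_ord j))).

Definition ess_sup_Rd (d : nat) (g : ('I_d -> R) -> R) : \bar R :=
  ereal_inf [set y : \bar R |
     integral_Rd d (fun x => (indic [set z | y < (g z)%:E] x)%:E) = (0%R)%:E].

(* The L^p norm, p in (0, +oo], of a function whose pointwise modulus is g,
   following MathComp-Analysis's [Lnorm] (hoelder.v). *)
Definition Lpnorm_ (d : nat) (p : \bar R) (g : ('I_d -> R) -> R) : \bar R :=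
  match p with
  | EFin r => poweR (integral_Rd d (fun x => (powR (g x) r)%:E)) (Rinv r)
  | +oo => ess_sup_Rd d g
  | -oo => (0%R)%:E
  end.

Definition Rbar_to_ereal (x : Rbar) : \bar R :=
  match x with Coquelicot.Rbar.Finite r => r%:E | p_infty => +oo | m_infty => -oo end.
Definition ereal_to_Rbar (x : \bar R) : Rbar :=
  match x with EFin r => Coquelicot.Rbar.Finite r | +oo => p_infty | -oo => m_infty end.
End LpImpl.

Definition Lpnorm (d : nat) (p : Rbar) (f : ('I_d -> R) -> C) : Rbar :=
  LpImpl.ereal_to_Rbar
    (LpImpl.Lpnorm_ d (LpImpl.Rbar_to_ereal p) (fun x => Cmod (f x))).

Definition eucl_norm (d : nat) (x : 'I_d -> R) : R :=
  sqrt (\big[Rplus/0]_(j < d) (x j)^2).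

Definition shift (d : nat) (x : 'I_d -> R) (j : 'I_d) (s : R) : 'I_d -> R :=
  fun k => if k == j then x k + s else x k.

Definition second_partial (d : nat) (j : 'I_d) (f : ('I_d -> R) -> C)
    (x : 'I_d -> R) (l : C) : Prop :=
  exists g : R -> C,
    locally 0 (fun s => is_derive (fun u => f (shift d x j u)) s (g s)) /\
    is_derive g 0 l.

Definition laplacian_is (d : nat) (f : ('I_d -> R) -> C) (x : 'I_d -> R)
    (l : C) : Prop :=
  exists D : 'I_d -> C, (forall j, second_partial d j f x (D j)) /\
    l = \big[Cplus/RtoC 0]_(j < d) D j.

(* real power u^y for u >= 0, y > 0, with the convention 0^y = 0
   (Stdlib's Rpower 0 y is exp (y * ln 0) = 1, hence the guard). *)
Definition rpow (u y : R) : R := if Req_EM_T u 0 then 0 else Rpower u y.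

Definition L_ (a Tc t : R) : R := sqrt (2 * a * (Tc - t)).
Definition tau_ (a Tc t : R) : R := / (2 * a) * ln (Tc / (Tc - t)).

Definition psi_explicit (d : nat) (sigma a Tc : R) (Q : R -> C)
    (t : R) (x : 'I_d -> R) : C :=
  (RtoC (/ Rpower (L_ a Tc t) (/ sigma))
    * Q ((eucl_norm d x / L_ a Tc t)%R)
    * (cos (tau_ a Tc t), sin (tau_ a Tc t)))%C.

(* Main.v *)
(* Write d = k + 1, Y = Q', m = |Q|^2, e = |Y|^2, W = Im (Y conj Q), J = Re (Y conj Q).

   Origin: (r^k Y + i a r^(k+1) Q)' = r^k G(r) with G continuous at 0 and free of Y, so
   Y / r has a limit at 0, and Q(|x|) is twice differentiable along coordinate lines
   even at x = 0.

   Decay: the derivative of r^k W + (a/2) r^(k+1) m is a (d/2 - 1/sigma) r^k m <= 0, hence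
   a r m <= - 2 W and a^2 r^2 m <= 4 e.  The corrected energy
   H = e - m + m^(sigma+1) / (sigma+1) + (2/sigma) J / r then satisfies
   H' <= kappa H / r + O(e / r^3) with kappa = 2/sigma - 2 k, and H >= e / 2 for large r; so
   e = O(r^kappa) and |Q| = O(r^(-(d - 1/sigma))).  This is in L^p since
   p > p^* means p (d - 1/sigma) > d.

   Blow-up: |Q| is bounded below near 0, so |psi| >= c L^(-1/sigma) on a cube of side
   comparable to L, and the L^p norm is at least c L^(d/p - 1/sigma), where p > p^* > sigma d. *)
Require Import Defs.
From Stdlib Require Import Reals Lra Lia.
From Coquelicot Require Import Coquelicot.
From mathcomp Require all_boot all_order all_algebra.
From mathcomp Require all_classical all_reals all_analysis measurable_realfun.
From mathcomp Require Rstruct Rstruct_topology.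
Open Scope R_scope.

(** * Lower and upper bounds for iterated integrals *)

(** At infinity the linear part of the profile equation has two modes, of modulus r^(-1/sigma) and
    r^(1/sigma - d); the second carries the phase exp (- i a r^2 / 2). As sigma d < 2, the second
    decays more slowly, so its rate is the one to establish. For it |Q'| is about a r |Q|: hence the
    estimate controls e first, and m is recovered from a^2 r^2 m <= 4 e. The plain energy e - m +
    m^(sigma+1) / (sigma+1) has derivative - 2 k e / r - (2 a / sigma) W. Here W can be as large as
    a multiple of e / r, the size of the main term, so it cannot count as an error. The derivative
    of (2/sigma) J / r cancels it exactly and adds (2/sigma) e / r, which is the origin of kappa.
    For the norms, psi is compared with products of one-variable functions, whose iterated integrals
    can be evaluated exactly. *)

Module LpBounds.
Local Set Implicit Arguments.
Local Unset Strict Implicit.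
Import all_boot all_order all_algebra.
Import all_classical all_reals all_analysis measurable_realfun Rstruct Rstruct_topology.
Import Order.TTheory GRing.Theory Num.Theory numFieldNormedType.Exports.
Import LpImpl.
Local Open Scope classical_set_scope.
Local Open Scope ring_scope.
Local Open Scope ereal_scope.

Section integral_facts.
Context {R : realType}.
Local Notation mu := (@lebesgue_measure R).

(** The integral of a nonnegative function, measurable or not, is a supremum over the simple
    functions below it. This form suits the inner iterated integrals, whose measurability is never
    established. *)
Lemma integral_mono (f g : R -> \bar R) : (forall x, 0 <= f x) ->
  (forall x, f x <= g x) -> \int[mu]_x f x <= \int[mu]_x g x.
Proof.
move=> f0 fg.
rewrite ge0_integralTE// ge0_integralTE; last by move=> x; apply: le_trans (fg x).
by apply: ereal_sup_le => _ [h hf <-]; exists h => // x; apply: le_trans (fg x).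
Qed.

(** Symmetry reduces the integral to the half line, where [- (q - 1)^-1 * (1 + x)^(1 - q)] is a
    primitive that vanishes at infinity because [q > 1]. *)
Lemma integral_powR_japanese (q : R) : (1 < q)%R ->
  exists I : R, [/\ (0 <= I)%R, measurable_fun [set: R] (fun x => (1 + `|x|) `^ (- q))%R &
    \int[mu]_x ((1 + `|x|) `^ (- q))%:E = I%:E].
Proof.
move=> q1.
have q0 : (0 < q - 1)%R by rewrite subr_gt0.
have cf : continuous (fun x : R => (1 + `|x|) `^ (- q))%R.
  move=> x.
  have x0 : (0 < 1 + `|x|)%R by rewrite ltr_pwDl.
  apply: (@continuous_comp _ _ _ (fun x : R => 1 + `|x|)%R (fun y => y `^ (-q))%R).
    by apply: cvgD; [exact: cvg_cst | exact: norm_continuous].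
  apply: differentiable_continuous; apply/derivable1_diffP.
  by apply: derivable_powR; rewrite in_itv/= x0.
exists (2 * (q - 1)^-1)%R; split;
  [by rewrite mulr_ge0// invr_ge0 ltW | exact: continuous_measurable_fun |].
have pow0 (x : R) : (0 <= (1 + `|x|) `^ (- q))%R by exact: powR_ge0.
have sym : (fun x : R => (1 + `|x|) `^ (- q))%R =1 (fun x : R => (1 + `|x|) `^ (- q))%R \o -%R.
  by move=> x /=; rewrite normrN.
rewrite (ge0_symfun_integralT pow0 cf sym).
rewrite EFinM; congr (_ * _); rewrite -set_itvcy.
have D (x : R) : (0 < x)%R -> is_derive x 1%R (fun y => - (q - 1)^-1 * (1 +
  y) `^ (1 - q))%R ((1 + x) `^ (- q))%R.
  move=> x0.
  have x1 : (0 < 1 + x)%R by rewrite addr_gt0.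
  have P : is_derive (1 + x)%R 1%R (fun y : R => y `^ (1 - q))%R ((1 - q) * (1 +
    x) `^ (1 - q - 1))%R.
    exact: is_derive1_powR.
  have P1 : is_derive x 1%R (fun y : R => 1 + y)%R (0 + 1)%R by exact: is_deriveD.
  have P2 := @is_derive1_comp R (fun y : R => y `^ (1 - q))%R (fun y : R => 1 + y)%R x _ _ P P1.
  have P3 := is_deriveZ (- (q - 1)^-1)%R P2.
  apply: (is_derive_eq P3); rewrite addrAC subrr !add0r mulr1.
  by rewrite /GRing.scale /= mulrA mulNr -mulrN opprB mulVf ?mul1r// gt_eqF.
rewrite (@ge0_continuous_FTC2y _ (fun x => (1 + `|x|) `^ (- q))%R
   (fun x => - (q - 1)^-1 * (1 + x) `^ (1 - q))%R 0%R 0%R).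
- by rewrite addr0 powR1 mulr1 EFinN oppeK add0e.
- by move=> x _; exact: powR_ge0.
- exact: continuous_subspaceT.
- rewrite -(mulr0 (- (q - 1)^-1)%R); apply: cvgMr.
  apply/cvgr0Pnorm_lt => e e0; near=> x.
  have Mx : (e `^ (- (q - 1)^-1) < 1 + x)%R.
    by rewrite ltr_pwDl// ltW//; near: x; exact: nbhs_pinfty_gt.
  rewrite ger0_norm ?powR_ge0// -opprB powRN -[ltRHS]invrK ltf_pV2 ?posrE ?invr_gt0 ?powR_gt0//;
    last first.
    by apply: lt_trans Mx; rewrite powR_gt0.
  have := @gt0_ltr_powR _ _ q0 (e `^ (- (q - 1)^-1))%R (1 + x)%R.
  rewrite !nnegrE powR_ge0 (ltW (lt_trans (powR_gt0 _ e0) Mx)) Mx -powRrM mulNr mulVf ?gt_eqF//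
    powR_inv1 ?ltW//.
  by apply.
- by move=> x x0; case: (D x x0).
- apply: cvg_at_right_filter; apply: cvgMr.
  apply: (@continuous_comp _ _ _ (fun x : R => 1 + x)%R (fun y => y `^ (1 - q))%R).
    by apply: cvgD; [exact: cvg_cst | exact: id].
  apply: differentiable_continuous; apply/derivable1_diffP.
  by apply: derivable_powR; rewrite in_itv/= addr0 ltr01.
- move=> x; rewrite in_itv/= andbT => x0; rewrite derive1E.
  by case: (D x x0) => _ ->; rewrite ger0_norm// ltW.
Unshelve. all: by end_near. Qed.

Lemma powR_powR_prod (d : nat) (x b r : R) : (d != 0)%N ->
  ((x `^ (- b)) `^ r = \prod_(j < d) x `^ (- (b * r / d%:R)))%R.
Proof.
move=> d0; rewrite prodr_const card_ord.
rewrite -powR_mulrn; last exact: powR_ge0.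
rewrite -powRrM.
rewrite -powRrM.
by rewrite !mulNr divfK// pnatr_eq0.
Qed.

End integral_facts.

Lemma iint_ge0 m F : (forall y, 0 <= F y) -> 0 <= iint m F.
Proof. by elim: m F => [|m IH] F F0 /=; [exact: F0 | apply: integral_ge0 => s _; exact: IH]. Qed.

Lemma iint_mono m F G : (forall y, 0 <= F y) -> (forall y, F y <= G y) ->
  iint m F <= iint m G.
Proof.
elim: m F G => [|m IH] F G F0 FG /=; first exact: FG.
by apply: integral_mono => s; [exact: iint_ge0 | exact: IH].
Qed.

(** The constant [c] is there for the induction: it absorbs the factor [h s] of the outermost
    variable before the inner integral is evaluated. *)
Lemma iint_prod m (h : R -> R) (I c : R) : (forall s, (0 <= h s)%R) ->
  @measurable_fun _ _ (measurableTypeR R) (measurableTypeR R) setT h ->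
    \int[lebesgue_measure]_s (h s)%:E = I%:E -> (0 <= c)%R ->
  iint m (fun y => (c * \prod_(j < m) h (y j))%:E) = (c * I ^+ m)%:E.
Proof.
move=> h0 mh hI.
have I0 : (0 <= I)%R by rewrite -lee_fin -hI; apply: integral_ge0 => s _; rewrite lee_fin.
elim: m c => [|m IH] c c0 /=; first by rewrite big_ord0 expr0.
transitivity (\int[lebesgue_measure]_s ((c * I ^+ m)%:E * (h s)%:E)).
  apply: eq_integral => s _.
  rewrite -EFinM mulrAC -(IH (c * h s)%R) ?mulr_ge0//; congr iint.
  apply/funext => y; congr EFin; rewrite big_ord_recr /= -mulrA [in RHS](mulrC (h s)).
  congr (_ * (_ * _))%R; last by rewrite /upd eqxx.
  by apply: eq_bigr => i _; rewrite /upd /= ltn_eqF.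
rewrite (ge0_integralZl_EFin _ measurableT); first by rewrite hI -EFinM exprSr mulrA.
- by move=> s _; rewrite lee_fin; exact: h0.
- exact/measurable_EFinP.
- by rewrite mulr_ge0// exprn_ge0.
Qed.

Lemma eucl_normE d (x : 'I_d -> R) :
  eucl_norm d x = Num.sqrt (\sum_(j < d) x j ^+ 2)%R.
Proof. by rewrite /eucl_norm RsqrtE; congr Num.sqrt; apply: eq_bigr => j _; rewrite RpowE. Qed.

Lemma norm_coord_le_eucl_norm d (x : 'I_d -> R) j : (`|x j| <= eucl_norm d x)%R.
Proof.
rewrite eucl_normE -sqrtr_sqr ler_wsqrtr// (bigD1 j)//= lerDl sumr_ge0// => i _.
exact: sqr_ge0.
Qed.

Lemma eucl_norm_ge0 d (x : 'I_d -> R) : (0 <= eucl_norm d x)%R.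
Proof. by rewrite eucl_normE sqrtr_ge0. Qed.

Lemma eucl_norm_cube_le d (x : 'I_d -> R) (l : R) :
  ((forall j, 0 <= x j <= l) -> eucl_norm d x <= INR d * l)%coqR.
Proof.
move=> xl'; have xl j : (0 <= x j <= l)%R.
  by have [/RleP -> /RleP ->] := xl' j.
apply/RleP; rewrite INRE RmultE eucl_normE.
have [d0|d0] := eqVneq d 0%N; first by subst d; rewrite big_ord0 sqrtr0 mul0r.
have l0 : (0 <= l)%R.
  have d1 : (0 < d)%N by rewrite lt0n.
  by have /andP[/le_trans] := xl (Ordinal d1); apply.
rewrite -[leRHS]ger0_norm ?mulr_ge0// -sqrtr_sqr ler_wsqrtr//.
apply: (@le_trans _ _ (\sum_(j < d) l ^+ 2)%R).
  by apply: ler_sum => j _; have /andP[x0 x1] := xl j; rewrite lerXn2r// nnegrE.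
rewrite sumr_const card_ord exprMn -[leLHS]mulr_natl ler_wpM2r ?sqr_ge0// expr2.
by rewrite -natrM ler_nat leq_pmulr// lt0n.
Qed.

Lemma RpowerE (x y : R) : (0 < x)%R -> Rpower x y = (x `^ y)%R.
Proof. by move=> x0; rewrite /Rpower /powR gt_eqF// RexpE RlnE. Qed.

Lemma integral_Rd_ge0 d f : (forall x, 0 <= f x) -> 0 <= integral_Rd d f.
Proof. by move=> f0; apply: iint_ge0. Qed.

(** The indicator of the cube is a product of indicators of [[0, l]], hence a minorant to which
    [iint_prod] applies. *)
Lemma integral_Rd_cube_ge d (c l : R) f : (0 <= c)%R -> (0 < l)%R -> (forall x, 0 <= f x) ->
  (forall x, (forall j, 0 <= x j <= l)%R -> c%:E <= f x) ->
  (c * l ^+ d)%:E <= integral_Rd d f.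
Proof.
move=> c0 l0 f0 cf.
pose h (s : R) : R := \1_([set` `[0%R, l]] : set (measurableTypeR R)) s.
have h0 s : (0 <= h s)%R by rewrite /h indicE.
rewrite -(@iint_prod d h l c) //; first last.
- rewrite /h integral_indic//= setIT lebesgue_measure_itv /= lte_fin l0.
  by rewrite oppr0 adde0.
- exact: measurable_indic.
apply: iint_mono => y.
  by rewrite lee_fin mulr_ge0// prodr_ge0.
have [/forallP xl|/forallPn[j xj]] := boolP [forall j : 'I_d, (0 <= y j <= l)%R].
  rewrite (_ : (\prod_(j < d) h (y j))%R = 1%R) ?mulr1; first exact: cf.
  by apply: big1 => j _; rewrite /h indicE mem_set//= in_itv/= xl.
rewrite (bigD1 j)//= {1}/h indicE memNset ?mul0r ?mulr0//=.
by rewrite in_itv/=; apply/negP.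
Qed.

Lemma Rbar_lt_ereal_to_Rbar (x : \bar R) : x < +oo -> Rbar_lt (ereal_to_Rbar x) p_infty.
Proof. by case: x. Qed.

Lemma Rbar_le_ereal_to_Rbar (K : R) (x : \bar R) : K%:E <= x ->
  Rbar_le (Rbar.Finite K) (ereal_to_Rbar x).
Proof. by case: x => //= r; rewrite lee_fin => /RleP. Qed.

(** Since |x_j| <= |x|, the power (1 + |x|)^(- b r) is at most the product over j of (1 + |x_j|)^(-
    b r / d), and each factor is integrable on the line because b r / d > 1. *)
Lemma Lpnorm_lt_pinfty d (r b K : R) (f : ('I_d -> R) -> C) :
  (0 < r -> INR d < b * r -> 0 <= K ->
  (forall x, Cmod (f x) <= K * Rpower (1 + eucl_norm d x) (- b)) ->
  Rbar_lt (Lpnorm d (Rbar.Finite r) f) p_infty)%coqR.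
Proof.
move=> /RltP r0 /RltP; rewrite INRE => br /RleP K0 fK.
apply: Rbar_lt_ereal_to_Rbar => /=; apply: poweR_lty.
have [d0|d0] := eqVneq d 0%N.
  by subst d; rewrite /integral_Rd /= ltry.
have dR0 : (0 < d%:R :> R)%R by rewrite ltr0n lt0n.
have q1 : (1 < b * r / d%:R)%R by rewrite ltr_pdivlMr// mul1r.
have [I [I0 mh hI]] := integral_powR_japanese q1.
set q := (b * r / d%:R)%R in q1 mh hI.
pose h (s : R) : R := ((1 + `|s|) `^ (- q))%R.
apply: (@le_lt_trans _ _ (K `^ r * I ^+ d)%:E); last exact: ltry.
rewrite -(@iint_prod d h I (K `^ r)%R) ?powR_ge0//; last by move=> s; exact: powR_ge0.
apply: iint_mono => y; first by rewrite lee_fin powR_ge0.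
rewrite lee_fin; set x := (fun j : 'I_d => y j).
have e0 := eucl_norm_ge0 x.
have e1 : (0 < 1 + eucl_norm d x)%R by rewrite ltr_pwDl.
apply: (@le_trans _ _ ((K * (1 + eucl_norm d x) `^ (- b)) `^ r)%R).
  apply: ge0_ler_powR; rewrite ?nnegrE ?(ltW r0)//.
  - exact/RleP/Cmod_ge_0.
  - by rewrite mulr_ge0// powR_ge0.
  - by apply/RleP; rewrite -RpowerE//; exact: fK.
rewrite powRM ?powR_ge0// ler_wpM2l ?powR_ge0//.
have -> : (((1 + eucl_norm d x) `^ (- b)) `^ r = \prod_(j < d) (1 + eucl_norm d x) `^ (- q))%R.
  exact: powR_powR_prod.
apply: ler_prod => j _; rewrite powR_ge0 /= /h !powRN lef_pV2 ?posrE ?powR_gt0 ?ltr_pwDl//.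
apply: ge0_ler_powR; rewrite ?nnegrE ?addr_ge0// ?lerD2l; last exact: norm_coord_le_eucl_norm.
by apply: ltW; apply: lt_trans q1.
Qed.

Lemma Linftynorm_lt_pinfty d (K : R) (f : ('I_d -> R) -> C) :
  (forall x, Cmod (f x) <= K)%coqR -> Rbar_lt (Lpnorm d p_infty f) p_infty.
Proof.
move=> fK; apply: Rbar_lt_ereal_to_Rbar => /=.
apply: (@le_lt_trans _ _ K%:E); last exact: ltry.
apply: ereal_inf_lbound => /=.
(* The modulus nowhere exceeds [K], so the indicator is 0; the product form lets [iint_prod]
   evaluate its integral. *)
rewrite (_ : (fun x => _) = fun x => (0 * \prod_(j < d) (fun=> 0) (x j))%:E); last first.
  apply/funext => x; rewrite mul0r indicE memNset//= lte_fin => /RltP.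
  by move=> /Rlt_not_le; apply; exact: fK.
rewrite /integral_Rd (@iint_prod d (fun=> 0%R) 0%R 0%R) ?mul0r//.
  exact: integral0.
Qed.

Lemma Lpnorm_cube_ge d (r l K : R) (f : ('I_d -> R) -> C) :
  (0 < r -> 0 < l -> 0 <= K ->
  (forall x, (forall j, 0 <= x j <= l) -> K <= Cmod (f x)) ->
  Rbar_le (K * Rpower l (INR d / r)) (Lpnorm d (Rbar.Finite r) f))%coqR.
Proof.
move=> /RltP r0 /RltP l0 /RleP K0 fK.
apply: Rbar_le_ereal_to_Rbar => /=.
have f0 x : (0 <= Cmod (f x))%R by exact/RleP/Cmod_ge_0.
have -> : (K * Rpower l (INR d / r))%coqR%:E = poweR (K `^ r * l ^+ d)%:E (Rinv r).
  rewrite poweR_EFin powRM ?powR_ge0 ?exprn_ge0// ?(ltW l0)// -powRrM RinvE divff ?gt_eqF//.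
  rewrite powRr1// RpowerE// -powR_mulrn ?(ltW l0)// -powRrM RdivE INRE //.
apply: gt0_ler_poweR; rewrite ?RinvE ?invr_ge0 ?(ltW r0)// ?in_itv/= ?leey ?andbT.
- by rewrite lee_fin mulr_ge0 ?powR_ge0// exprn_ge0// ltW.
- by apply: integral_Rd_ge0 => x; rewrite lee_fin powR_ge0.
apply: integral_Rd_cube_ge; rewrite ?powR_ge0//.
  by move=> x; rewrite lee_fin powR_ge0.
move=> x xl; rewrite lee_fin; apply: ge0_ler_powR; rewrite ?nnegrE ?(ltW r0)//.
by apply/RleP; apply: fK => j; have /andP[/RleP ? /RleP ?] := xl j.
Qed.

(** An essential bound [y < K] would make the cube part of a null set, against its volume
    [l ^ d > 0]. *)
Lemma Linftynorm_cube_ge d (l K : R) (f : ('I_d -> R) -> C) :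
  (0 < l ->
  (forall x, (forall j, 0 <= x j <= l) -> K <= Cmod (f x)) ->
  Rbar_le K (Lpnorm d p_infty f))%coqR.
Proof.
move=> /RltP l0 fK.
apply: Rbar_le_ereal_to_Rbar => /=; apply: le_ereal_inf_tmp => y /= y0.
rewrite leNgt; apply/negP => yK.
have : (1 * l ^+ d)%:E <= 0%:E.
  rewrite -y0; apply: integral_Rd_cube_ge => //.
  move=> x xl; rewrite indicE mem_set//=; apply: lt_le_trans yK _.
    by rewrite lee_fin; apply/RleP; apply: fK => j; have /andP[/RleP ? /RleP ?] := xl j.
by rewrite lee_fin mul1r leNgt exprn_gt0.
Qed.

(** * Coordinate lines and sums over coordinates *)

Section coordinate_sums.
Local Open Scope ring_scope.

(** [S] is the sum of the other squared coordinates. Along a coordinate line a radial function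
    becomes a function of [sqrt (S + w ^ 2)] with [w = x j + s]. *)
Lemma eucl_norm_shift d (x : 'I_d -> R) j :
  (exists S, 0 <= S /\
    (forall s, eucl_norm d (Defs.shift d x j s) = sqrt (S + (x j + s) ^ 2)) /\
    eucl_norm d x = sqrt (S + (x j) ^ 2))%coqR.
Proof.
exists (\sum_(i < d | i != j) x i ^+ 2); split; first by apply/RleP/sumr_ge0 => i _; exact: sqr_ge0.
split=> [s|]; rewrite eucl_normE RsqrtE RpowE (bigD1 j)//= addrC //.
congr (Num.sqrt (_ + _)); last by rewrite /Defs.shift eqxx.
by apply: eq_bigr => i ij; rewrite /Defs.shift (negbTE ij).
Qed.

(** The second partial derivatives of a radial function have this form, with [al] and [be] depending
    on |x| only; the sum is its Laplacian. *)
Lemma Csum_affine_sq d (x : 'I_d -> R) (al be : C) :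
  (\big[Cplus/RtoC 0]_(j < d) (al + RtoC (x j ^ 2) * be) =
   RtoC (INR d) * al + RtoC (eucl_norm d x ^ 2) * be)%C.
Proof.
have P (F : 'I_d -> C) : \big[Cplus/RtoC 0]_(j < d) F j =
    (\sum_(j < d) (F j).1, \sum_(j < d) (F j).2).
  by elim/big_rec3: _ => // j a b _ _ ->.
have S (a1 b1 : R) : \sum_(j < d) (a1 + x j ^+ 2 * b1) = d%:R * a1 + eucl_norm d x ^+ 2 * b1.
  rewrite eucl_normE sqr_sqrtr; last by apply: sumr_ge0 => i _; exact: sqr_ge0.
  by rewrite big_split /= sumr_const card_ord -mulr_suml mulr_natl.
have SR (a1 b1 : R) (F : 'I_d -> R) : (forall j, F j = a1 + b1 * (x j ^ 2)%coqR)%coqR ->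
    \sum_(j < d) F j = (INR d * a1 + (eucl_norm d x ^ 2) * b1)%coqR.
  move=> FE; rewrite RplusE !RmultE INRE RpowE -S; apply: eq_bigr => j _.
  by rewrite FE RplusE RmultE RpowE mulrC.
rewrite P; congr pair.
  rewrite (SR al.1 be.1) => [|j]; rewrite /= -?RplusE -?RmultE; ring.
rewrite (SR al.2 be.2) => [|j]; rewrite /=; ring.
Qed.

End coordinate_sums.
End LpBounds.

(** * Calculus near the origin *)

Section real_functions.

Lemma decreasing_of_derive (f f' : R -> R) (x y : R) : x <= y ->
  (forall z, x <= z <= y -> is_derive f z (f' z)) ->
  (forall z, x <= z <= y -> f' z <= 0) -> f y <= f x.
Proof.
intros Hxy Hd Hneg.
destruct (Req_dec x y) as [->|Hne]; [lra|].
destruct (MVT_cor2 f f' x y) as [c [Hc Hcxy]]; [lra| |].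
  intros c Hc; apply is_derive_Reals, Hd; lra.
assert (f' c <= 0) by (apply Hneg; lra).
nra.
Qed.

Lemma Rpower_pos (x y : R) : 0 < Rpower x y.
Proof. apply exp_pos. Qed.

Lemma rpow_0 (s : R) : rpow 0 s = 0.
Proof. unfold rpow; destruct (Req_EM_T 0 0); simpl; congruence. Qed.

Lemma rpow_pos (x s : R) : 0 < x -> rpow x s = Rpower x s.
Proof. intros Hx; unfold rpow; destruct (Req_EM_T x 0); simpl; [lra|reflexivity]. Qed.

Lemma rpow_ge0 (x s : R) : 0 <= rpow x s.
Proof.
unfold rpow; destruct (Req_EM_T x 0); simpl; [lra|].
left; apply Rpower_pos.
Qed.

(* The absolute value makes [y * abspow s y] differentiable at [0] from both sides. *)
Definition abspow (s x : R) : R := rpow (Rabs x) s.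

Lemma abspow_0 s : abspow s 0 = 0.
Proof. unfold abspow; rewrite Rabs_R0; apply rpow_0. Qed.

Lemma abspow_pos s x : 0 < x -> abspow s x = Rpower x s.
Proof. intros Hx; unfold abspow; rewrite Rabs_pos_eq by lra; now apply rpow_pos. Qed.

Lemma abspow_ge0 s x : 0 <= abspow s x.
Proof. apply rpow_ge0. Qed.

Lemma abspow_near_0 s eps : 0 < s -> 0 < eps ->
  exists delta, 0 < delta /\ forall x, Rabs x < delta -> abspow s x < eps.
Proof.
intros Hs He; exists (Rpower eps (/ s)); split; [apply Rpower_pos|].
intros x Hx; unfold abspow.
destruct (Rabs_pos x) as [H0|<-]; [|rewrite rpow_0; lra].
rewrite rpow_pos by lra.
rewrite <- (Rpower_1 eps) by lra.
replace 1 with (/ s * s) by (field; lra).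
rewrite <- Rpower_mult.
apply Rlt_Rpower_l; lra.
Qed.

Lemma continuous_abspow s x : 0 < s -> 0 <= x -> continuous (abspow s) x.
Proof.
intros Hs [Hx|<-].
- apply (continuous_ext_loc _ (fun y => Rpower y s)).
    exists (mkposreal x Hx); intros y Hy; symmetry; apply abspow_pos.
    unfold ball in Hy; simpl in Hy; unfold AbsRing_ball, abs, minus, plus, opp in Hy; simpl in Hy.
    apply Rabs_def2 in Hy; lra.
  apply (ex_derive_continuous (fun y => Rpower y s)).
  unfold Rpower; auto_derive; lra.
- apply filterlim_locally; intros eps.
  destruct (abspow_near_0 s eps Hs (cond_pos eps)) as [del [Hd H]].
  exists (mkposreal del Hd); intros y Hy.
  unfold ball in *; simpl in *; unfold AbsRing_ball, abs, minus, plus, opp in *; simpl in *.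
  rewrite abspow_0, Ropp_0, Rplus_0_r in *.
  rewrite Rabs_pos_eq by apply abspow_ge0. now apply H.
Qed.

(** With y = |Q|^2 this differentiates |Q|^(2 sigma + 2), including at zeros of Q, where [abspow]
    alone may fail to be differentiable. *)
Lemma is_derive_mul_abspow s x : 0 < s -> 0 <= x ->
  is_derive (fun y => y * abspow s y) x ((s + 1) * abspow s x).
Proof.
intros Hs [Hx|<-].
- apply (is_derive_ext_loc (fun y => y * Rpower y s)).
    exists (mkposreal x Hx); intros y Hy; rewrite abspow_pos; [reflexivity|].
    unfold ball in Hy; simpl in Hy; unfold AbsRing_ball, abs, minus, plus, opp in Hy; simpl in Hy.
    apply Rabs_def2 in Hy; lra.
  rewrite abspow_pos by lra. unfold Rpower; auto_derive; [lra|field; lra].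
- rewrite abspow_0, Rmult_0_r.
  apply is_derive_Reals; intros eps He.
  destruct (abspow_near_0 s eps Hs He) as [del [Hd H]].
  exists (mkposreal del Hd); intros h Hh0 Hh; simpl in Hh.
  rewrite Rplus_0_l, Rmult_0_l, !Rminus_0_r.
  replace (h * abspow s h / h) with (abspow s h) by (field; lra).
  rewrite Rabs_pos_eq by apply abspow_ge0. now apply H.
Qed.

Lemma rpow_sqrt (s x : R) : 0 <= x -> rpow (sqrt x) (2 * s) = abspow s x.
Proof.
intros [Hx|<-].
- rewrite abspow_pos by lra. pose proof (sqrt_lt_R0 x Hx).
  rewrite rpow_pos by lra. rewrite <- Rpower_mult. f_equal.
  rewrite <- (Rpower_sqrt x Hx), Rpower_mult.
  replace (/ 2 * 2) with 1 by field. now apply Rpower_1.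
- rewrite sqrt_0, abspow_0. apply rpow_0.
Qed.

Lemma exp_increasing_le (x y : R) : x <= y -> exp x <= exp y.
Proof. intros [H| ->]; [left; now apply exp_increasing|right; reflexivity]. Qed.

Lemma rpow_Cmod (z : C) (s : R) : rpow (Cmod z) (2 * s) = abspow s (fst z ^ 2 + snd z ^ 2).
Proof. unfold Cmod; apply rpow_sqrt; nra. Qed.

Lemma rpow_mult (A y s : R) : 0 < A -> 0 <= y -> rpow (A * y) s = Rpower A s * rpow y s.
Proof.
intros HA [Hy|<-].
- rewrite !rpow_pos by nra. symmetry; now apply Rpower_mult_distr.
- rewrite Rmult_0_r, rpow_0; ring.
Qed.

End real_functions.

(** * One-sided limits at the origin *)

Local Notation lim0 f l := (filterlim f (at_right 0) (locally (l : R))) (only parsing).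

Section limits.

Lemma lim0P (f : R -> R) (l : R) : lim0 f l <->
  (forall eps, 0 < eps -> exists delta, 0 < delta /\
     forall r, 0 < r < delta -> Rabs (f r - l) < eps).
Proof.
split.
- intros H eps He.
  destruct (proj1 (filterlim_locally f l) H (mkposreal eps He)) as [del Hd].
  exists del; split; [apply cond_pos|]. intros r Hr; apply (Hd r); [|lra].
  unfold ball; simpl; unfold AbsRing_ball, abs, minus, plus, opp; simpl.
  rewrite Ropp_0, Rplus_0_r, Rabs_pos_eq; lra.
- intros H; apply filterlim_locally; intros eps.
  destruct (H eps (cond_pos eps)) as [del [Hd Hr]].
  exists (mkposreal del Hd); intros y Hy Hy0.
  unfold ball in *; simpl in *; unfold AbsRing_ball, abs, minus, plus, opp in *; simpl in *.
  apply (Hr y). rewrite Ropp_0, Rplus_0_r, Rabs_pos_eq in Hy; lra.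
Qed.

Lemma lim0_const (c : R) : lim0 (fun _ => c) c.
Proof. apply filterlim_const. Qed.

Lemma lim0_id : lim0 (fun r => r) 0.
Proof. apply lim0P; intros eps He; exists eps; split; [lra|]; intros r Hr;
  rewrite Rminus_0_r, Rabs_pos_eq; lra. Qed.

Lemma lim0_plus (f g : R -> R) (l m : R) : lim0 f l -> lim0 g m ->
  lim0 (fun r => f r + g r) (l + m).
Proof. intros Hf Hg; eapply filterlim_comp_2; [exact Hf|exact Hg|apply (filterlim_plus l m)]. Qed.

Lemma lim0_mult (f g : R -> R) (l m : R) : lim0 f l -> lim0 g m ->
  lim0 (fun r => f r * g r) (l * m).
Proof. intros Hf Hg; eapply filterlim_comp_2; [exact Hf|exact Hg|apply (filterlim_mult l m)]. Qed.

Lemma lim0_ext (f g : R -> R) (l m : R) : (forall r, 0 < r -> f r = g r) -> l = m -> lim0 f l ->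
  lim0 g m.
Proof.
intros E <- Hf; apply (filterlim_ext_loc f); [|exact Hf].
exists (mkposreal 1 Rlt_0_1); intros y _ Hy; now apply E.
Qed.

Lemma lim0_pow (k : nat) : lim0 (fun r => r ^ S k) 0.
Proof.
induction k as [|k IH].
- apply (lim0_ext (fun r => r)) with (2 := eq_refl); [intros; ring|apply lim0_id].
- apply (lim0_ext (fun r => r * r ^ S k) _ (0 * 0)); [intros; reflexivity|ring|].
  apply lim0_mult; [apply lim0_id|exact IH].
Qed.

Lemma lim0_le (f : R -> R) (l c : R) (eps : R) : 0 < eps -> lim0 f l ->
  (forall r, 0 < r < eps -> c <= f r) -> c <= l.
Proof.
intros He Hf H. apply Rnot_lt_le; intros Hlt.
destruct (proj1 (lim0P f l) Hf (c - l)) as [del [Hd Hr]]; [lra|].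
assert (0 < Rmin eps del) by (apply Rmin_pos; lra).
pose proof (Rmin_l eps del); pose proof (Rmin_r eps del).
specialize (H (Rmin eps del / 2)); specialize (Hr (Rmin eps del / 2)).
assert (G1 := H ltac:(lra)). assert (G2 := Hr ltac:(lra)). apply Rabs_def2 in G2. lra.
Qed.

(* The hypothesis on [P] only asks for [0] as a cluster value at [0+], which is
   what the mean value theorem provides. *)
Lemma primitive_pow_asymptotic (P g : R -> R) (g0 : R) (k : nat) :
  (forall r, 0 < r -> is_derive P r (r ^ k * g r)) ->
  lim0 g g0 ->
  (forall eta delta, 0 < eta -> 0 < delta -> exists xi, 0 < xi < delta /\ Rabs (P xi) <= eta) ->
  lim0 (fun r => P r / r ^ S k) (g0 / INR (S k)).
Proof.
intros HP Hg Hc. assert (Hk : 0 < INR (S k)) by (apply lt_0_INR; lia).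
(* For [c = g0 + eps] and [c = g0 - eps], the difference between [P] and [c * s ^ S k / INR (S k)]
   is monotone and has cluster value 0 at the origin, which fixes its sign. *)
assert (K : forall eps r, 0 < r -> (forall s, 0 < s <= r -> Rabs (g s - g0) <= eps) ->
   P r <= (g0 + eps) * r ^ S k / INR (S k) /\ (g0 - eps) * r ^ S k / INR (S k) <= P r).
  intros eps r Hr Hgr.
  assert (D : forall c s, 0 < s -> is_derive (fun s => P s - c * s ^ S k / INR (S k)) s (s ^ k *
    (g s - c))).
    intros c s Hs. evar_last.
      apply (is_derive_minus P (fun s => c * s ^ S k / INR (S k))); [now apply HP|].
      auto_derive; [trivial|reflexivity].
    unfold minus, plus, opp; simpl pred; simpl. field. change (INR (S k) <> 0); lra.
  assert (L : forall c eta, 0 < eta ->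
    exists xi, 0 < xi < r /\ Rabs (P xi - c * xi ^ S k / INR (S k)) <= eta).
    intros c eta He.
    assert (T : lim0 (fun s => c / INR (S k) * s ^ S k) (c / INR (S k) * 0)).
      apply lim0_mult; [apply lim0_const|apply lim0_pow].
    rewrite Rmult_0_r in T.
    destruct (proj1 (lim0P _ _) T (eta / 2)) as [del [Hd Hx]]; [lra|].
    destruct (Hc (eta / 2) (Rmin del r)) as [xi [Hxi HPx]]; [lra|apply Rmin_pos; lra|].
    pose proof (Rmin_l del r); pose proof (Rmin_r del r).
    exists xi; split; [lra|]. specialize (Hx xi ltac:(lra)). rewrite Rminus_0_r in Hx.
    replace (P xi - c * xi ^ S k / INR (S k)) with (P xi +
      - (c / INR (S k) * xi ^ S k)) by (field; lra).
    eapply Rle_trans; [apply Rabs_triang|]. rewrite Rabs_Ropp. lra.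
  split; apply Rnot_lt_le; intros Hlt.
  - set (c := g0 + eps) in *.
    destruct (L c ((P r - c * r ^ S k / INR (S k)) / 2)) as [xi [Hxi HL]]; [lra|].
    assert (P r - c * r ^ S k / INR (S k) <= P xi - c * xi ^ S k / INR (S k)).
      apply (decreasing_of_derive (fun s => P s - c * s ^ S k / INR (S k)) (fun s => s ^ k * (g s
        - c))); [lra| |].
      + intros z Hz; apply D; lra.
      + intros z Hz. assert (Hgz := Hgr z ltac:(lra)). apply Rabs_le_between in Hgz.
        assert (0 < z ^ k) by (apply pow_lt; lra). unfold c; nra.
    apply Rabs_le_between in HL. lra.
  - set (c := g0 - eps) in *.
    destruct (L c ((c * r ^ S k / INR (S k) - P r) / 2)) as [xi [Hxi HL]]; [lra|].
    assert (- (P r - c * r ^ S k / INR (S k)) <= - (P xi - c * xi ^ S k / INR (S k))).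
      apply (decreasing_of_derive (fun s => - (P s - c * s ^ S k / INR (S k))) (fun s => - (s ^ k
        * (g s - c)))); [lra| |].
      + intros z Hz; apply (is_derive_opp (fun s => P s - c * s ^ S k / INR (S k))), D; lra.
      + intros z Hz. assert (Hgz := Hgr z ltac:(lra)). apply Rabs_le_between in Hgz.
        assert (0 < z ^ k) by (apply pow_lt; lra). unfold c; nra.
    apply Rabs_le_between in HL. lra.
apply lim0P; intros eps He.
destruct (proj1 (lim0P g g0) Hg (eps / 2)) as [del [Hd Hr]]; [lra|].
exists del; split; [lra|]. intros r Hr0.
destruct (K (eps / 2) r) as [K1 K2]; [lra| |].
  intros s Hs; left; apply Hr; lra.
assert (Hp : 0 < r ^ S k) by (apply pow_lt; lra).
assert (HI : 1 <= INR (S k)) by (rewrite S_INR; pose proof (pos_INR k); lra).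
assert (E : P r / r ^ S k - g0 / INR (S k) = (P r * INR (S k) - g0 * r ^ S k) / (r ^ S k * INR (S
  k))) by (field; lra).
rewrite E. assert (Hq : 0 < r ^ S k * INR (S k)) by nra.
apply (Rmult_le_compat_r (INR (S k))) in K1; [|lra].
apply (Rmult_le_compat_r (INR (S k))) in K2; [|lra].
unfold Rdiv in K1, K2. rewrite Rmult_assoc, Rinv_l, Rmult_1_r in K1 by lra.
rewrite Rmult_assoc, Rinv_l, Rmult_1_r in K2 by lra.
apply Rabs_lt_between; split.
- apply Rmult_lt_reg_r with (1 := Hq). unfold Rdiv; rewrite Rmult_assoc, Rinv_l by lra. nra.
- apply Rmult_lt_reg_r with (1 := Hq). unfold Rdiv; rewrite Rmult_assoc, Rinv_l by lra. nra.
Qed.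

(** The mean value theorem is applied on [[h / 2, h]], away from 0. Both end values are within
    [eta / 4] times their abscissa of [f 0], so the slope is at most [3 / 4 * eta]. *)
Lemma derive_cluster_0 (f f1 : R -> R) :
  (forall r, 0 < r -> is_derive f r (f1 r)) ->
  lim0 (fun h => (f h - f 0) / h) 0 ->
  forall eta delta, 0 < eta -> 0 < delta -> exists xi, 0 < xi < delta /\ Rabs (f1 xi) <= eta.
Proof.
intros Hf Hl eta delta He Hd.
destruct (proj1 (lim0P _ _) Hl (eta / 4)) as [del [Hdel Hr]]; [lra|].
assert (Hm : 0 < Rmin del delta) by (apply Rmin_pos; lra).
pose proof (Rmin_l del delta); pose proof (Rmin_r del delta).
assert (Hh : exists h, 0 < h < del /\ h < delta) by (exists (Rmin del delta / 2); lra).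
destruct Hh as [h [Hh1 Hh2]].
destruct (MVT_cor2 f f1 (h / 2) h) as [c [Hc Hch]]; [lra| |].
  intros c Hc; apply is_derive_Reals, Hf; lra.
exists c; split; [lra|].
assert (B : forall x, 0 < x < del -> - (eta / 4 * x) <= f x - f 0 <= eta / 4 * x).
  intros x Hx. specialize (Hr x Hx). rewrite Rminus_0_r in Hr. apply Rabs_def2 in Hr.
  assert (E : f x - f 0 = (f x - f 0) / x * x) by (field; lra). rewrite E. nra.
assert (B1 := B h ltac:(lra)). assert (B2 := B (h / 2) ltac:(lra)).
apply Rabs_le; nra.
Qed.

Lemma lim0_of_quotient (f : R -> R) (l c : R) : lim0 (fun h => (f h - c) / h) l -> lim0 f c.
Proof.
intros H. apply (lim0_ext (fun h => (f h - c) / h * h + c) _ (l * 0 + c)); [intros; field;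
  lra|ring|].
apply lim0_plus; [apply lim0_mult; [exact H|apply lim0_id]|apply lim0_const].
Qed.

(** Composing with [Rabs] turns right continuity at 0 into continuity, so that the extreme value
    theorem applies on [[0, b]]. *)
Lemma bounded_of_continuous (f : R -> R) (b : R) : 0 <= b ->
  (forall r, 0 < r -> continuous f r) -> lim0 f (f 0) ->
  exists M, forall r, 0 <= r <= b -> f r <= M.
Proof.
intros Hb Hc Hl.
destruct (continuity_ab_maj (fun r => f (Rabs r)) 0 b Hb) as [c [Hm _]].
- intros r Hr. apply continuity_pt_filterlim.
  destruct (proj1 Hr) as [Hr0|<-].
  + apply (continuous_comp Rabs f); [apply continuous_Rabs|].
    apply Hc, Rabs_pos_lt; lra.
  + rewrite Rabs_R0. apply filterlim_locally; intros eps.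
    destruct (proj1 (lim0P _ _) Hl eps (cond_pos eps)) as [del [Hd H]].
    exists (mkposreal del Hd); intros y Hy.
    unfold ball in *; simpl in *; unfold AbsRing_ball, abs, minus, plus, opp in *; simpl in *.
    rewrite Ropp_0, Rplus_0_r in Hy.
    destruct (Rabs_pos y) as [Hy0|<-].
      now apply H.
    rewrite Rplus_opp_r, Rabs_R0; apply cond_pos.
- exists (f (Rabs c)); intros r Hr. rewrite <- (Rabs_pos_eq r) by lra. now apply Hm.
Qed.

End limits.

Ltac derive_unique :=
  repeat match goal with
  | H : is_derive ?f ?x ?l |- context [Derive ?g ?x] =>
      replace (Derive g x) with l by (symmetry; exact (is_derive_unique f x l H))
  end.

(** * The radial equation: regularity at the origin and momentum *)

Lemma origin_half (k : nat) (a sigma : R) (u v u1 v1 u2 n : R -> R) (n0 : R) : 0 < sigma ->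
  (forall r, 0 < r -> is_derive u r (u1 r)) ->
  (forall r, 0 < r -> is_derive v r (v1 r)) ->
  (forall r, 0 < r -> is_derive u1 r (u2 r)) ->
  (forall r, 0 < r -> u2 r = - (INR k / r) * u1 r + u r + a * (/ sigma * v r +
    r * v1 r) - n r * u r) ->
  lim0 (fun h => (u h - u 0) / h) 0 -> lim0 (fun h => (v h - v 0) / h) 0 -> lim0 n n0 ->
  lim0 (fun r => u1 r / r)
    (((1 - n0) * u 0 - a * (INR (S k) - / sigma) * v 0) / INR (S k) + a * v 0).
Proof.
intros Hs Du Dv Du1 E Lu Lv Ln.
pose proof (lim0_of_quotient _ _ _ Lu) as Cu. pose proof (lim0_of_quotient _ _ _ Lv) as Cv.
set (g := fun r => (1 + - n r) * u r + - a * (INR (S k) - / sigma) * v r).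
assert (Lg : lim0 g ((1 + - n0) * u 0 + - a * (INR (S k) - / sigma) * v 0)).
  apply lim0_plus; apply lim0_mult; try assumption; try apply lim0_const.
  apply lim0_plus; [apply lim0_const|].
  apply (lim0_ext (fun r => (-1) * n r) _ (-1 * n0)); [intros; ring|ring|].
  apply lim0_mult; [apply lim0_const|exact Ln].
(* Real part of [r^k Q' + i a r^(k+1) Q]; its derivative no longer involves [Q']. *)
set (P := fun r => r ^ k * u1 r - a * (r ^ S k * v r)).
assert (DP : forall r, 0 < r -> is_derive P r (r ^ k * g r)).
  intros r Hr. specialize (Dv r Hr); specialize (Du1 r Hr). unfold P.
  auto_derive.
    repeat split; eexists; eassumption.
  derive_unique. rewrite E by assumption. unfold g. rewrite S_INR.
  destruct k as [|k]; simpl pred.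
    simpl; field; lra.
  rewrite <- tech_pow_Rmult. field; lra.
(* No limit of [u1] at 0 is known yet, only the cluster value 0; it passes to [P] because
   [r ^ k <= 1] for [r <= 1]. *)
assert (HP : forall eta delta, 0 < eta -> 0 < delta ->
  exists xi, 0 < xi < delta /\ Rabs (P xi) <= eta).
  intros eta delta He Hd.
  assert (T : lim0 (fun r => a * (r ^ S k * v r)) (a * (0 * v 0))).
    apply lim0_mult; [apply lim0_const|]. apply lim0_mult; [apply lim0_pow|exact Cv].
  rewrite Rmult_0_l, Rmult_0_r in T.
  destruct (proj1 (lim0P _ _) T (eta / 2)) as [del [Hdel Hr]]; [lra|].
  assert (Hm : 0 < Rmin 1 (Rmin del delta)) by (repeat apply Rmin_pos; lra).
  destruct (derive_cluster_0 u u1 Du Lu (eta / 2) _ ltac:(lra) Hm) as [xi [Hxi Hu]].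
  pose proof (Rmin_l 1 (Rmin del delta)); pose proof (Rmin_r 1 (Rmin del delta)).
  pose proof (Rmin_l del delta); pose proof (Rmin_r del delta).
  exists xi; split; [lra|]. specialize (Hr xi ltac:(lra)). rewrite Rminus_0_r in Hr.
  unfold P, Rminus; eapply Rle_trans; [apply Rabs_triang|]. rewrite Rabs_Ropp.
  rewrite Rabs_mult.
  assert (Rabs (xi ^ k) <= 1).
    rewrite Rabs_pos_eq by (apply pow_le; lra). rewrite <- (pow1 k). apply pow_incr; lra.
  pose proof (Rabs_pos (u1 xi)). pose proof (Rabs_pos (xi ^ k)). nra.
pose proof (primitive_pow_asymptotic P g _ k DP Lg HP) as L.
apply (lim0_ext (fun r => P r / r ^ S k + a * v r) _
  (((1 + - n0) * u 0 + - a * (INR (S k) - / sigma) * v 0) / INR (S k) + a * v 0)).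
- intros r Hr; unfold P. simpl. field. repeat split; first [apply pow_nonzero; lra|lra].
- field. split; [|apply not_0_INR; lia]; lra.
- apply lim0_plus; [exact L|]. apply lim0_mult; [apply lim0_const|exact Cv].
Qed.

Section real_profile.
Context (k : nat) (a sigma : R) (u v u1 v1 u2 v2 : R -> R).
Context (Ha : 0 < a) (Hsigma : 0 < sigma) (Hd : sigma * INR (S k) < 2).
Context (Du : forall r, 0 < r -> is_derive u r (u1 r)).
Context (Dv : forall r, 0 < r -> is_derive v r (v1 r)).
Context (Du1 : forall r, 0 < r -> is_derive u1 r (u2 r)).
Context (Dv1 : forall r, 0 < r -> is_derive v1 r (v2 r)).
Let m r := u r ^ 2 + v r ^ 2.
Let n r := abspow sigma (m r).
Context (Eu : forall r, 0 < r ->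
  u2 r = - (INR k / r) * u1 r + u r + a * (/ sigma * v r + r * v1 r) - n r * u r).
Context (Ev : forall r, 0 < r ->
  v2 r = - (INR k / r) * v1 r + v r - a * (/ sigma * u r + r * u1 r) - n r * v r).
Context (Lu : lim0 (fun h => (u h - u 0) / h) 0) (Lv : lim0 (fun h => (v h - v 0) / h) 0).

Let Cu : lim0 u (u 0). Proof. exact (lim0_of_quotient _ _ _ Lu). Qed.
Let Cv : lim0 v (v 0). Proof. exact (lim0_of_quotient _ _ _ Lv). Qed.

Let m_ge0 r : 0 <= m r. Proof. unfold m; nra. Qed.

Let Ln : lim0 n (n 0).
Proof.
apply (filterlim_comp _ _ _ m (abspow sigma) (at_right 0) (locally (m 0)));
  [|apply (continuous_abspow sigma (m 0) Hsigma (m_ge0 0))].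
apply (lim0_ext (fun r => u r * u r + v r * v r) _ (u 0 * u 0 + v 0 * v 0)); [intros; unfold m;
  ring|unfold m; ring|].
apply lim0_plus; apply lim0_mult; assumption.
Qed.

Lemma profile_origin_re : lim0 (fun r => u1 r / r)
  (((1 - n 0) * u 0 - a * (INR (S k) - / sigma) * v 0) / INR (S k) + a * v 0).
Proof. exact (origin_half k a sigma u v u1 v1 u2 n (n 0) Hsigma Du Dv Du1 Eu Lu Lv Ln). Qed.

Lemma profile_origin_im : lim0 (fun r => v1 r / r)
  (((1 - n 0) * v 0 + a * (INR (S k) - / sigma) * u 0) / INR (S k) - a * u 0).
Proof.
(* [i conj Q], with components [v] and [u], solves the equation with [- a] for [a]. *)
pose proof (origin_half k (- a) sigma v u v1 u1 v2 n (n 0) Hsigma Dv Du Dv1) as H.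
eapply lim0_ext; [| |apply H]; try assumption; try (intros; reflexivity).
- field. split; [|apply not_0_INR; lia]; lra.
- intros r Hr; rewrite Ev by assumption; ring.
Qed.

Let e r := u1 r ^ 2 + v1 r ^ 2.
Let W r := u r * v1 r - v r * u1 r.

Lemma lim0_u1 : lim0 u1 0.
Proof.
eapply (lim0_ext (fun r => u1 r / r * r)); [intros; field; lra| |apply lim0_mult;
  [apply profile_origin_re|apply lim0_id]].
ring.
Qed.

Lemma lim0_v1 : lim0 v1 0.
Proof.
eapply (lim0_ext (fun r => v1 r / r * r)); [intros; field; lra| |apply lim0_mult;
  [apply profile_origin_im|apply lim0_id]].
ring.
Qed.

Lemma momentum_bound r : 0 < r -> W r + a / 2 * r * m r <= 0.
Proof.
intros Hr.
set (F := fun r => r ^ k * (W r + a / 2 * (r * m r))).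
set (F1 := fun r => a * r ^ k * m r * (INR (S k) / 2 - / sigma)).
assert (DF : forall s, 0 < s -> is_derive F s (F1 s)).
  intros s Hs. pose proof (Du s Hs); pose proof (Dv s Hs); pose proof (Du1 s Hs);
    pose proof (Dv1 s Hs).
  unfold F, W, m. auto_derive.
    repeat split; eexists; eassumption.
  derive_unique. rewrite Eu, Ev by assumption. unfold F1, n, m. rewrite S_INR.
  destruct k as [|k']; simpl pred.
    simpl; field; lra.
  rewrite <- tech_pow_Rmult. field; lra.
(* For [k = 0] the weight [r ^ k] does not vanish at the origin, so the bracket itself must tend to
   0; this uses [u1, v1 -> 0]. *)
assert (LF : lim0 F 0).
  assert (B : lim0 (fun r => W r + a / 2 * (r * m r)) 0).
    apply (lim0_ext (fun r => (u r * v1 r + -1 * (v r * u1 r)) + a / 2 * (r * (u r * u r +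
      v r * v r))) _
      ((u 0 * 0 + -1 * (v 0 * 0)) + a / 2 * (0 * (u 0 * u 0 + v 0 * v 0)))).
    - intros; unfold W, m; ring.
    - ring.
    - pose proof lim0_u1; pose proof lim0_v1; pose proof lim0_id.
      repeat first [apply lim0_plus | apply lim0_mult]; try assumption; apply lim0_const.
  destruct k as [|k'] eqn:Ek.
  - apply (lim0_ext (fun r => W r + a / 2 * (r * m r)) _ 0); [intros; unfold F; simpl;
    ring|reflexivity|exact B].
  - eapply (lim0_ext (fun r => r ^ S k' * (W r + a / 2 * (r * m r))));
    [reflexivity| |apply lim0_mult; [apply lim0_pow|exact B]]; ring.
assert (HF : F r <= 0).
  apply (lim0_le F 0 (F r) r Hr LF). intros s Hs.
  apply (decreasing_of_derive F F1); [lra| |].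
  - intros z Hz; apply DF; lra.
  - intros z Hz; unfold F1.
    assert (INR (S k) / 2 - / sigma <= 0).
      apply Rmult_le_reg_l with (1 := Hsigma). rewrite Rmult_minus_distr_l, Rinv_r by lra. lra.
    assert (0 < a * z ^ k) by (apply Rmult_lt_0_compat; [|apply pow_lt]; lra).
    pose proof (m_ge0 z). assert (0 <= a * z ^ k * m z) by nra. nra.
unfold F in HF. assert (0 < r ^ k) by (apply pow_lt; lra).
apply Rnot_lt_le; intros Hlt. nra.
Qed.

Lemma modulus_le_derivative r : 0 < r -> a ^ 2 * r ^ 2 * m r <= 4 * e r.
Proof.
intros Hr. pose proof (momentum_bound r Hr) as H.
(* Lagrange's identity: [e * m - W ^ 2] is the square of [u * u1 + v * v1]. *)
assert (HW : W r ^ 2 <= e r * m r).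
  unfold W, e, m. pose proof (pow2_ge_0 (u r * u1 r + v r * v1 r)). nra.
destruct (m_ge0 r) as [Hm|Hm].
- assert (0 <= a / 2 * r * m r) by (apply Rmult_le_pos; nra).
  assert ((a / 2 * r * m r) ^ 2 <= W r ^ 2) by nra.
  apply Rmult_le_reg_r with (1 := Hm). nra.
- rewrite <- Hm. unfold e. nra.
Qed.

End real_profile.

(** * Decay at infinity *)

Section decay.
Context (k : nat) (a sigma : R) (u v u1 v1 u2 v2 : R -> R).
Context (Ha : 0 < a) (Hsigma : 0 < sigma) (Hd : sigma * INR (S k) < 2).
Context (Du : forall r, 0 < r -> is_derive u r (u1 r)).
Context (Dv : forall r, 0 < r -> is_derive v r (v1 r)).
Context (Du1 : forall r, 0 < r -> is_derive u1 r (u2 r)).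
Context (Dv1 : forall r, 0 < r -> is_derive v1 r (v2 r)).
Let m r := u r ^ 2 + v r ^ 2.
Let n r := abspow sigma (m r).
Context (Eu : forall r, 0 < r ->
  u2 r = - (INR k / r) * u1 r + u r + a * (/ sigma * v r + r * v1 r) - n r * u r).
Context (Ev : forall r, 0 < r ->
  v2 r = - (INR k / r) * v1 r + v r - a * (/ sigma * u r + r * u1 r) - n r * v r).
Let e r := u1 r ^ 2 + v1 r ^ 2.
Let J r := u r * u1 r + v r * v1 r.
Context (Hb : forall r, 0 < r -> a ^ 2 * r ^ 2 * m r <= 4 * e r).

Let N r := m r * n r / (sigma + 1).
Let kappa := 2 / sigma - 2 * INR k.
(* The last term is chosen so that [u v1 - v u1] cancels from the derivative of [H]. *)
Let H r := e r - m r + N r + 2 / sigma * (J r / r).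
Let H1 r := kappa * e r / r + 2 / sigma * (m r - m r * n r) / r - 2 / sigma * INR (S k) * J r / r
  ^ 2.

Let m_ge0 r : 0 <= m r. Proof. unfold m; nra. Qed.
Let e_ge0 r : 0 <= e r. Proof. unfold e; nra. Qed.
Let n_ge0 r : 0 <= n r. Proof. apply abspow_ge0. Qed.

Let is_derive_H r : 0 < r -> is_derive H r (H1 r).
Proof.
intros Hr. pose proof (Du r Hr); pose proof (Dv r Hr); pose proof (Du1 r Hr); pose proof (Dv1 r Hr).
assert (Dm : is_derive m r (2 * J r)).
  unfold m; auto_derive; [repeat split; eexists; eassumption|]. derive_unique. unfold J; ring.
assert (DN : is_derive (fun s => m s * n s) r (2 * J r * ((sigma + 1) * n r))).
  apply (is_derive_comp (fun y => y * abspow sigma y) m); [|exact Dm].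
  apply is_derive_mul_abspow; [exact Hsigma|apply m_ge0].
unfold H.
apply (is_derive_ext (fun s => (u1 s ^ 2 + v1 s ^ 2) - m s + (m s * n s) * / (sigma + 1) +
  2 / sigma * ((u s * u1 s + v s * v1 s) / s))).
  intros s; reflexivity.
set (mn := fun s => m s * n s) in *.
change (fun s => u1 s ^ 2 + v1 s ^ 2 - m s + m s * n s * / (sigma + 1) +
  2 / sigma * ((u s * u1 s + v s * v1 s) / s))
  with (fun s => u1 s ^ 2 + v1 s ^ 2 - m s + mn s * / (sigma + 1) + 2 / sigma * ((u s * u1 s +
    v s * v1 s) / s)).
auto_derive.
  repeat split; try (eexists; eassumption); lra.
change (fun x => m x) with m. change (fun x => mn x) with mn.
derive_unique. rewrite Eu, Ev by assumption. unfold H1, kappa, J, e, m. rewrite S_INR. field.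
repeat split; lra.
Qed.

Let c1 := 4 / a ^ 2.
Let c2 := 2 / a.

Let m_le r : 0 < r -> m r <= c1 * (e r / r ^ 2).
Proof.
intros Hr. pose proof (Hb r Hr). unfold c1.
apply Rmult_le_reg_l with (a ^ 2 * r ^ 2); [apply Rmult_lt_0_compat; apply pow_lt; lra|].
replace (a ^ 2 * r ^ 2 * (4 / a ^ 2 * (e r / r ^ 2))) with (4 * e r) by (field; lra). lra.
Qed.

Let J_le r : 0 < r -> Rabs (J r) <= c2 * (e r / r).
Proof.
intros Hr. assert (Hq : 0 <= e r / r) by (apply Rdiv_le_0_compat; [apply e_ge0|lra]).
assert (Hc : 0 < c2) by (unfold c2; apply Rdiv_lt_0_compat; lra).
rewrite <- (Rabs_pos_eq (c2 * (e r / r))) by nra.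
apply Rsqr_le_abs_0. unfold Rsqr.
assert (J r * J r <= e r * m r).
  unfold J, e, m. pose proof (pow2_ge_0 (u r * v1 r - v r * u1 r)). nra.
replace (c2 * (e r / r) * (c2 * (e r / r))) with (e r * (c1 * (e r / r ^ 2))) by (unfold c1, c2;
  field; lra).
eapply Rle_trans; [eassumption|]. apply Rmult_le_compat_l; [apply e_ge0|now apply m_le].
Qed.

Let C := (Rabs kappa + 2 / sigma) * c1 + 2 / sigma * (Rabs kappa + INR (S k)) * c2.

Let H1_le r : 0 < r -> H1 r <= kappa * H r / r + C * (e r / r ^ 3).
Proof.
intros Hr. pose proof (m_le r Hr) as Bm. pose proof (J_le r Hr) as BJ.
assert (Hs : 0 < 2 / sigma) by (apply Rdiv_lt_0_compat; lra).
pose proof (Rle_abs kappa). pose proof (Rle_abs (- kappa)) as Hk'. rewrite Rabs_Ropp in Hk'.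
pose proof (Rabs_pos kappa).
assert (HD : 0 < INR (S k)) by (apply lt_0_INR; lia).
assert (E : H1 r - kappa * H r / r = (kappa + 2 / sigma) * (m r / r)
   - (kappa + 2 / sigma * (sigma + 1)) * (N r / r) + - (2 / sigma * (kappa +
     INR (S k))) * (J r / r ^ 2)).
  unfold H1, H, N. field. repeat split; lra.
assert (T1 : (kappa + 2 / sigma) * (m r / r) <= (Rabs kappa + 2 / sigma) * c1 * (e r / r ^ 3)).
  apply Rle_trans with ((Rabs kappa + 2 / sigma) * (m r / r)).
    apply Rmult_le_compat_r; [apply Rdiv_le_0_compat; [apply m_ge0|lra]|lra].
  rewrite Rmult_assoc. apply Rmult_le_compat_l; [lra|].
  apply Rmult_le_reg_r with (1 := Hr).
  replace (m r / r * r) with (m r) by (field; lra).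
  replace (c1 * (e r / r ^ 3) * r) with (c1 * (e r / r ^ 2)) by (field; lra). exact Bm.
assert (T2 : 0 <= (kappa + 2 / sigma * (sigma + 1)) * (N r / r)).
  apply Rmult_le_pos.
  - unfold kappa. rewrite S_INR in Hd. apply Rmult_le_reg_l with (1 := Hsigma).
    replace (sigma * (2 / sigma - 2 * INR k + 2 / sigma * (sigma + 1))) with (4 +
      2 * sigma - 2 * (sigma * INR k)) by (field; lra).
    lra.
  - apply Rdiv_le_0_compat; [|lra]. unfold N. apply Rdiv_le_0_compat; [|lra].
    apply Rmult_le_pos; [apply m_ge0|apply n_ge0].
assert (T3 : - (2 / sigma * (kappa + INR (S k))) * (J r / r ^ 2) <= 2 / sigma * (Rabs kappa +
  INR (S k)) * c2 * (e r / r ^ 3)).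
  eapply Rle_trans; [apply Rle_abs|].
    rewrite Rabs_mult, Rabs_Ropp, Rabs_mult, (Rabs_pos_eq (2 / sigma)) by lra.
  replace (2 / sigma * (Rabs kappa + INR (S k)) * c2 * (e r / r ^ 3))
    with (2 / sigma * (Rabs kappa + INR (S k)) * (c2 * (e r / r ^ 3))) by ring.
  apply Rmult_le_compat; [apply Rmult_le_pos; [lra|apply Rabs_pos]|apply Rabs_pos| |].
  - apply Rmult_le_compat_l; [lra|]. eapply Rle_trans; [apply Rabs_triang|].
    rewrite (Rabs_pos_eq (INR _)); lra.
  - unfold Rdiv at 1. rewrite Rabs_mult.
    assert (0 < / r ^ 2) by (apply Rinv_0_lt_compat, pow_lt; lra).
    rewrite (Rabs_pos_eq (/ r ^ 2)) by lra.
    replace (c2 * (e r / r ^ 3)) with (c2 * (e r / r) * / r ^ 2) by (field; lra).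
    apply Rmult_le_compat_r; lra.
unfold C. rewrite Rmult_plus_distr_r. lra.
Qed.

Let C2 := c1 + 2 / sigma * c2.
(** For r >= [R1] one has r^2 >= r >= 2 [C2], so the terms of [H] in [m] and [J] cost at most half
    of [e]. *)
Let R1 := 1 + 2 * C2.

Let C2_ge0 : 0 <= C2.
Proof.
unfold C2, c1, c2. apply Rplus_le_le_0_compat.
  apply Rdiv_le_0_compat; [lra|apply pow_lt; lra].
apply Rmult_le_pos; apply Rdiv_le_0_compat; lra.
Qed.

Let C_ge0 : 0 <= C.
Proof.
pose proof (pos_INR (S k)). pose proof (Rabs_pos kappa).
assert (0 < 2 / sigma) by (apply Rdiv_lt_0_compat; lra).
assert (0 < c1) by (apply Rdiv_lt_0_compat; [lra|apply pow_lt; lra]).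
assert (0 < c2) by (apply Rdiv_lt_0_compat; lra).
unfold C. apply Rplus_le_le_0_compat; apply Rmult_le_pos; try lra.
apply Rmult_le_pos; lra.
Qed.

Let H_ge r : R1 <= r -> e r / 2 <= H r.
Proof.
intros Hr. pose proof C2_ge0. assert (Hr1 : 1 <= r) by (unfold R1 in Hr; lra).
pose proof (m_le r ltac:(lra)) as Bm. pose proof (J_le r ltac:(lra)) as BJ.
assert (Hs : 0 < 2 / sigma) by (apply Rdiv_lt_0_compat; lra).
assert (HN : 0 <= N r).
  unfold N. apply Rdiv_le_0_compat; [|lra]. apply Rmult_le_pos; [apply m_ge0|apply n_ge0].
assert (HJ : - (c2 * (e r / r ^ 2)) <= J r / r).
  apply Rmult_le_reg_r with r; [lra|].
  replace (J r / r * r) with (J r) by (field; lra).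
  replace (- (c2 * (e r / r ^ 2)) * r) with (- (c2 * (e r / r))) by (field; lra).
  apply Rabs_le_between in BJ; lra.
assert (HE : C2 * (e r / r ^ 2) <= e r / 2).
  assert (Hr2 : 2 * C2 <= r ^ 2) by (unfold R1 in Hr;
    assert (1 * r <= r * r) by (apply Rmult_le_compat_r; lra); lra).
  assert (Hp : 0 < r ^ 2) by (apply pow_lt; lra).
  apply Rmult_le_reg_r with (1 := Hp).
  replace (C2 * (e r / r ^ 2) * r ^ 2) with (C2 * e r) by (field; lra).
  pose proof (e_ge0 r). nra.
unfold H. unfold C2 in HE.
assert (2 / sigma * - (c2 * (e r / r ^ 2)) <= 2 / sigma * (J r / r)) by (apply Rmult_le_compat_l;
  lra).
lra.
Qed.

Lemma derivative_decay : exists K R0, 1 <= R0 /\ 0 <= K /\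
  forall r, R0 <= r -> e r <= K * Rpower r (2 / sigma - 2 * INR k).
Proof.
assert (HR1 : 1 <= R1) by (pose proof C2_ge0; unfold R1; lra).
(* Integrating factor. The part [exp (C / r ^ 2)] stays bounded and contributes
   [- 2 * C * H / r ^ 3], which absorbs the error [C * e / r ^ 3] since [H >= e / 2]. *)
set (w := fun r => exp (- kappa * ln r + C / r ^ 2)).
set (G := fun r => H r * w r).
set (G1 := fun r => (H1 r - kappa * H r / r - 2 * C * H r / r ^ 3) * w r).
assert (DG : forall r, 0 < r -> is_derive G r (G1 r)).
  intros r Hr. pose proof (is_derive_H r Hr) as DH.
  assert (Dw : is_derive w r ((- kappa / r - 2 * C / r ^ 3) * w r)).
    unfold w. clearbody kappa C. auto_derive.
      split; [lra|]. split; [apply Rgt_not_eq; nra|trivial].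
    simpl. unfold Rdiv. field. lra.
  evar_last; [apply (is_derive_mult H w r _ _ DH Dw); intros; apply Rmult_comm|].
  unfold G1, plus, mult; simpl. field. lra.
assert (GR : forall r, R1 <= r -> G r <= G R1).
  intros r Hr. apply (decreasing_of_derive G G1); [exact Hr| |].
    intros z Hz; apply DG; lra.
  intros z Hz. unfold G1. pose proof (H1_le z ltac:(lra)) as B.
    pose proof (H_ge z ltac:(lra)) as B2.
  assert (0 < / z ^ 3) by (apply Rinv_0_lt_compat, pow_lt; lra).
  assert (C * (e z / z ^ 3) <= 2 * C * H z / z ^ 3).
    unfold Rdiv. rewrite <- Rmult_assoc. apply Rmult_le_compat_r; [lra|]. pose proof C_ge0. nra.
  assert (0 < w z) by apply exp_pos. nra.
assert (HG : 0 <= G R1).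
  apply Rmult_le_pos; [|left; apply exp_pos].
  pose proof (H_ge R1 (Rle_refl _)). pose proof (e_ge0 R1). lra.
exists (2 * G R1), R1. split; [exact HR1|]. split; [lra|]. intros r Hr.
pose proof (H_ge r Hr) as B. pose proof (GR r Hr) as B2.
fold kappa.
assert (E : H r = G r * exp (kappa * ln r - C / r ^ 2)).
  unfold G, w. rewrite Rmult_assoc, <- exp_plus.
  replace (- kappa * ln r + C / r ^ 2 + (kappa * ln r - C / r ^ 2)) with 0 by ring.
  rewrite exp_0; ring.
assert (exp (kappa * ln r - C / r ^ 2) <= Rpower r kappa).
  unfold Rpower. assert (0 <= C / r ^ 2) by (apply Rdiv_le_0_compat; [apply C_ge0|apply pow_lt;
    lra]).
  destruct (Req_dec (C / r ^ 2) 0) as [->|]; [right; f_equal; ring|].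
  left; apply exp_increasing; lra.
pose proof (exp_pos (kappa * ln r - C / r ^ 2)).
assert (H r <= G R1 * Rpower r kappa).
  rewrite E. apply Rle_trans with (G R1 * exp (kappa * ln r - C / r ^ 2)).
    apply Rmult_le_compat_r; lra.
  apply Rmult_le_compat_l; lra.
lra.
Qed.

Lemma modulus_decay : exists K R0, 1 <= R0 /\ 0 <= K /\
  forall r, R0 <= r -> sqrt (m r) <= K * Rpower (1 + r) (- (INR (S k) - / sigma)).
Proof.
destruct derivative_decay as [K [R0 [HR0 [HK B]]]].
assert (Hc1 : 0 < c1) by (apply Rdiv_lt_0_compat; [lra|apply pow_lt; lra]).
set (b := INR (S k) - / sigma).
assert (Hb0 : 0 <= K * c1) by (apply Rmult_le_pos; lra).
(* The power of 2 pays for replacing r by 1 + r, as r <= 1 + r <= 2 r for r >= 1. *)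
exists (sqrt (K * c1) * Rpower 2 (Rabs b)), R0. split; [exact HR0|]. split.
  apply Rmult_le_pos; [apply sqrt_pos|left; apply Rpower_pos].
intros r Hr.
assert (Hm : m r <= K * c1 * Rpower r (- b) ^ 2).
  eapply Rle_trans; [apply m_le; lra|].
  (* With d = k + 1, the exponent kappa - 2 equals - 2 (d - 1/sigma). *)
  replace (Rpower r (- b) ^ 2) with (Rpower r (2 / sigma - 2 * INR k) / r ^ 2).
    pose proof (B r Hr). assert (0 < / r ^ 2) by (apply Rinv_0_lt_compat, pow_lt; lra).
    unfold Rdiv in *. apply Rle_trans with (c1 * (K * Rpower r (2 * / sigma - 2 * INR k) * / r ^
      2)).
      apply Rmult_le_compat_l; [lra|]. apply Rmult_le_compat_r; lra.
    right; ring.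
  rewrite <- !Rpower_pow by (try apply Rpower_pos; lra).
  rewrite Rpower_mult. unfold Rdiv. rewrite <- Rpower_Ropp, <- Rpower_plus. f_equal.
  unfold b. rewrite (S_INR k). simpl. field. lra.
assert (E : sqrt (m r) <= sqrt (K * c1) * Rpower r (- b)).
  eapply Rle_trans; [apply sqrt_le_1_alt, Hm|].
  rewrite sqrt_mult_alt by assumption. right; f_equal. apply sqrt_pow2. left; apply Rpower_pos.
eapply Rle_trans; [exact E|]. rewrite Rmult_assoc. apply Rmult_le_compat_l; [apply sqrt_pos|].
unfold Rpower. rewrite <- exp_plus.
assert (L1 : 0 <= ln (1 + r) - ln r <= ln 2).
  split; [pose proof (ln_increasing r (1 + r)); lra|].
  rewrite Rplus_comm in *. assert (ln (r + 1) <= ln (2 * r)).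
    destruct (Req_dec r 1) as [->|]; [right; f_equal; ring|left; apply ln_increasing; lra].
  rewrite ln_mult in H0 by lra. lra.
assert (L2 : - b * ln r <= Rabs b * ln 2 + - b * ln (1 + r)).
  assert (b * (ln (1 + r) - ln r) <= Rabs b * ln 2).
    apply Rle_trans with (Rabs b * (ln (1 + r) - ln r)).
      apply Rmult_le_compat_r; [lra|apply Rle_abs].
    apply Rmult_le_compat_l; [apply Rabs_pos|lra].
  lra.
destruct L2 as [L2|L2]; [left; now apply exp_increasing|right; now f_equal].
Qed.
End decay.

(** * The explicit solution *)

Section complex_derivatives.

Lemma is_derive_fst (f : R -> C) (x : R) (l : C) :
  is_derive f x l -> is_derive (fun t => fst (f t)) x (fst l).
Proof.
intros H.
apply (filterdiff_comp' f (fun z : C => fst z) x (fun y => scal y l) (fun z : C => fst z));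
  [exact H|].
apply filterdiff_linear, is_linear_fst.
Qed.

Lemma is_derive_snd (f : R -> C) (x : R) (l : C) :
  is_derive f x l -> is_derive (fun t => snd (f t)) x (snd l).
Proof.
intros H.
apply (filterdiff_comp' f (fun z : C => snd z) x (fun y => scal y l) (fun z : C => snd z));
  [exact H|].
apply filterdiff_linear, is_linear_snd.
Qed.

Lemma is_derive_C (f : R -> C) (x : R) (l : C) :
  is_derive (fun t => fst (f t)) x (fst l) -> is_derive (fun t => snd (f t)) x (snd l) ->
  is_derive f x l.
Proof.
intros H1 H2.
apply (is_derive_ext (fun t => plus (scal (fst (f t)) ((1, 0) : C)) (scal (snd (f t)) ((0,
  1) : C)))).
  intros t; unfold plus, scal; simpl; unfold prod_plus, prod_scal, plus, scal; simpl;
    unfold mult; simpl.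
  destruct (f t) as [p q]; simpl; f_equal; ring.
replace l with (plus (scal (fst l) ((1, 0) : C)) (scal (snd l) ((0, 1) : C))).
  apply (is_derive_plus (V := prod_NormedModule R_AbsRing R_NormedModule R_NormedModule)).
    exact (is_derive_scal_l (V := prod_NormedModule R_AbsRing R_NormedModule R_NormedModule)
      (fun t => fst (f t)) x (fst l) (1, 0) H1).
  exact (is_derive_scal_l (V := prod_NormedModule R_AbsRing R_NormedModule R_NormedModule)
    (fun t => snd (f t)) x (snd l) (0, 1) H2).
unfold plus, scal; simpl; unfold prod_plus, prod_scal, plus, scal; simpl; unfold mult; simpl.
destruct l as [p q]; simpl; f_equal; ring.
Qed.

Lemma is_derive_Cmult_l (c : C) (f : R -> C) (x : R) (l : C) :
  is_derive f x l -> is_derive (fun t => (c * f t)%C) x (c * l)%C.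
Proof.
intros H. pose proof (is_derive_fst f x l H) as H1. pose proof (is_derive_snd f x l H) as H2.
apply is_derive_C; simpl.
- set (f1 := fun t => fst (f t)) in *; set (f2 := fun t => snd (f t)) in *.
  change (is_derive (fun t => fst c * f1 t - snd c * f2 t) x (fst c * fst l - snd c * snd l)).
  auto_derive; [repeat split; eexists; eassumption|]. derive_unique. ring.
- set (f1 := fun t => fst (f t)) in *; set (f2 := fun t => snd (f t)) in *.
  change (is_derive (fun t => fst c * f2 t + snd c * f1 t) x (fst c * snd l + snd c * fst l)).
  auto_derive; [repeat split; eexists; eassumption|]. derive_unique. ring.
Qed.

Lemma is_derive_translate (F : R -> R) (y s l : R) :
  is_derive F (y + s) l -> is_derive (fun s => F (y + s)) s l.
Proof.
intros H. evar_last.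
  apply (is_derive_comp F (fun s => y + s)); [exact H|]. auto_derive; [trivial|reflexivity].
unfold scal; simpl; unfold mult; simpl; ring.
Qed.

Lemma is_derive_translate_C (F : R -> C) (y s : R) (l : C) :
  is_derive F (y + s) l -> is_derive (fun s => F (y + s)) s l.
Proof.
intros H. apply is_derive_C.
- apply (is_derive_translate (fun w => fst (F w))), is_derive_fst, H.
- apply (is_derive_translate (fun w => snd (F w))), is_derive_snd, H.
Qed.

End complex_derivatives.

(** * Radial functions along a coordinate line *)

Section radial.
Context (f f1 f2 : R -> R) (q L S : R).
Context (Df : forall r, 0 < r -> is_derive f r (f1 r)).
Context (Df1 : forall r, 0 < r -> is_derive f1 r (f2 r)).
Context (L0 : lim0 (fun h => (f h - f 0) / h) 0).
Context (L1 : lim0 (fun r => f1 r / r) q).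
Context (HL : 0 < L) (HS : 0 <= S).

Let rho w := sqrt (S + w ^ 2) / L.
Let g w := f (rho w).
(* At [w = 0 = S] the quotient is junk, but the factor [w] gives the correct value [0]. *)
Let g1 w := w / L ^ 2 * (f1 (rho w) / rho w).

Let rho_pos w : 0 < S + w ^ 2 -> 0 < rho w.
Proof. intros H; apply Rdiv_lt_0_compat; [now apply sqrt_lt_R0|exact HL]. Qed.

Let Drho w : 0 < S + w ^ 2 -> is_derive rho w (w / (L ^ 2 * rho w)).
Proof.
intros H. pose proof (sqrt_lt_R0 _ H). unfold rho. auto_derive.
  replace (w * (w * 1)) with (w ^ 2) by ring; lra.
replace (w * (w * 1)) with (w ^ 2) by ring. field. lra.
Qed.

(** When [S = 0] the radius has a corner at [w = 0]; there the derivative exists because the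
    one-sided difference quotient of [f] tends to 0. *)
Lemma radial_derive w : is_derive g w (g1 w).
Proof.
assert (H : 0 < S + w ^ 2 \/ (S = 0 /\ w = 0)).
  destruct (Req_dec w 0) as [->|Hw]; [|left; pose proof (pow2_gt_0 w Hw); lra].
  destruct HS as [?|<-]; [left; simpl; lra|now right].
destruct H as [H|[HS0 ->]].
- pose proof (rho_pos w H) as Hr. evar_last.
    apply (is_derive_comp f rho); [now apply Df|now apply Drho].
  unfold scal; simpl; unfold mult; simpl. unfold g1. field. lra.
- unfold g1. unfold Rdiv at 1. rewrite !Rmult_0_l.
  apply is_derive_Reals; intros eps He.
  destruct (proj1 (lim0P _ _) L0 (L * eps)) as [del [Hd Hx]]; [nra|].
  assert (Hd' : 0 < del * L) by nra.
  exists (mkposreal _ Hd'); intros h Hh0 Hh; simpl in Hh.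
  unfold g, rho. rewrite HS0, !Rplus_0_l.
  replace (0 ^ 2) with 0 by ring. rewrite sqrt_0.
  replace (h ^ 2) with (Rsqr h) by (unfold Rsqr; ring). rewrite sqrt_Rsqr_abs.
  assert (Ha : 0 < Rabs h) by now apply Rabs_pos_lt.
  assert (Hq : 0 < Rabs h / L) by (apply Rdiv_lt_0_compat; lra).
  specialize (Hx (Rabs h / L)). rewrite Rminus_0_r in *.
  replace (0 / L) with 0 by (field; lra).
  assert (Hlt : Rabs h / L < del).
    apply Rmult_lt_reg_r with L; [lra|]. unfold Rdiv; rewrite Rmult_assoc, Rinv_l; lra.
  specialize (Hx (conj Hq Hlt)). unfold Rdiv in *.
  rewrite Rabs_mult in *. rewrite !Rabs_inv in *. rewrite (Rabs_pos_eq (Rabs h * / L)) in Hx by lra.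
  apply Rmult_lt_reg_l with (1 := HL).
  replace (L * (Rabs (f (Rabs h * / L) - f 0) * / Rabs h)) with (Rabs (f (Rabs h * / L) - f 0) *
    / (Rabs h * / L)) by (field; lra).
  exact Hx.
Qed.

(** The value is arranged as A + w^2 B, with A and B functions of the radius, to fit
    [Csum_affine_sq]. *)
Lemma radial_derive2 w : 0 < S + w ^ 2 ->
  is_derive g1 w (/ L ^ 2 * (f1 (rho w) / rho w) +
    w ^ 2 * (/ L ^ 2 * ((f2 (rho w) - f1 (rho w) / rho w) / (L ^ 2 * rho w ^ 2)))).
Proof.
intros H. pose proof (rho_pos w H) as Hr.
assert (Dphi : is_derive (fun y => f1 (rho y) / rho y) w
   ((f2 (rho w) / rho w - f1 (rho w) / rho w ^ 2) * (w / (L ^ 2 * rho w)))).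
  evar_last.
    apply (is_derive_comp (fun r => f1 r / r) rho); [|now apply Drho].
    pose proof (Df1 _ Hr). auto_derive; [repeat split; [eexists; eassumption|lra]|].
    derive_unique. reflexivity.
  unfold scal; simpl; unfold mult; simpl. field. lra.
set (phi := fun y => f1 (rho y) / rho y) in *.
change (is_derive (fun y => y / L ^ 2 * phi y) w (/ L ^ 2 * phi w +
    w ^ 2 * (/ L ^ 2 * ((f2 (rho w) - f1 (rho w) / rho w) / (L ^ 2 * rho w ^ 2))))).
auto_derive; [repeat split; eexists; eassumption|].
derive_unique. field. lra.
Qed.

Lemma radial_derive2_origin : S = 0 -> is_derive g1 0 (/ L ^ 2 * q).
Proof.
intros HS0. apply is_derive_Reals; intros eps He.
assert (HL2 : 0 < L ^ 2) by (apply pow_lt; lra).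
destruct (proj1 (lim0P _ _) L1 (L ^ 2 * eps)) as [del [Hd Hx]]; [nra|].
assert (Hd' : 0 < del * L) by nra.
exists (mkposreal _ Hd'); intros h Hh0 Hh; simpl in Hh.
assert (E0 : g1 0 = 0) by (unfold g1, Rdiv; ring).
rewrite E0, Rplus_0_l, Rminus_0_r.
unfold g1.
assert (Er : rho h = Rabs h / L).
  unfold rho. rewrite HS0, Rplus_0_l. replace (h ^ 2) with (Rsqr h) by (unfold Rsqr; ring).
  now rewrite sqrt_Rsqr_abs.
assert (Ha : 0 < Rabs h) by now apply Rabs_pos_lt.
assert (Hq : 0 < rho h) by (rewrite Er; apply Rdiv_lt_0_compat; lra).
assert (Hlt : rho h < del).
  rewrite Er. apply Rmult_lt_reg_r with L; [lra|]. unfold Rdiv; rewrite Rmult_assoc, Rinv_l; lra.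
specialize (Hx _ (conj Hq Hlt)).
replace (h / L ^ 2 * (f1 (rho h) / rho h) / h - / L ^ 2 * q) with (/ L ^ 2 * (f1 (rho h) / rho h
  - q)) by (field; lra).
rewrite Rabs_mult, Rabs_inv, (Rabs_pos_eq (L ^ 2)) by lra.
apply Rmult_lt_reg_l with (1 := HL2). rewrite <- Rmult_assoc, Rinv_r by lra. lra.
Qed.

End radial.

(** * Time derivatives of the scaling parameters *)

Section parameters.
Context (a Tc : R) (Ha : 0 < a).

Lemma L_pos t : t < Tc -> 0 < L_ a Tc t.
Proof. intros Ht; apply sqrt_lt_R0; nra. Qed.

Lemma L_sqr t : t < Tc -> L_ a Tc t ^ 2 = 2 * a * (Tc - t).
Proof. intros Ht; apply pow2_sqrt; nra. Qed.

Lemma is_derive_L t : t < Tc -> is_derive (L_ a Tc) t (- a / L_ a Tc t).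
Proof.
intros Ht. pose proof (L_pos t Ht). unfold L_ in *. auto_derive; [nra|]. unfold Rminus in *.
  field. lra.
Qed.

Lemma is_derive_tau t : 0 < Tc -> t < Tc -> is_derive (tau_ a Tc) t (/ L_ a Tc t ^ 2).
Proof.
intros HT Ht. rewrite L_sqr by exact Ht. unfold tau_. auto_derive.
  repeat split; try lra. apply Rmult_lt_0_compat; [exact HT|apply Rinv_0_lt_compat; lra].
field. repeat split; lra.
Qed.

Lemma is_derive_amplitude s t : t < Tc ->
  is_derive (fun t => / Rpower (L_ a Tc t) s) t (a * s / L_ a Tc t ^ 2 * / Rpower (L_ a Tc t) s).
Proof.
intros Ht. pose proof (L_pos t Ht) as HL. pose proof (is_derive_L t Ht) as DL.
unfold Rpower. set (l := L_ a Tc) in *. pose proof (exp_pos (s * ln (l t))).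
auto_derive.
  repeat split; [eexists; eassumption|exact HL|lra].
derive_unique. field. lra.
Qed.

End parameters.

Section complex_profile.
Context (k : nat) (sigma a : R) (Q Q1 Q2 : R -> C).
Context (Hsigma : 0 < sigma) (Ha : 0 < a) (Hd : sigma * INR (S k) < 2).
Context (DQ : forall rho, 0 < rho -> is_derive Q rho (Q1 rho)).
Context (DQ1 : forall rho, 0 < rho -> is_derive Q1 rho (Q2 rho)).
Context (EQ : forall rho, 0 < rho ->
     (Q2 rho + RtoC ((INR (S k) - 1) / rho) * Q1 rho - Q rho
      + Ci * RtoC a * (RtoC (/ sigma) * Q rho + RtoC rho * Q1 rho)
      + RtoC (rpow (Cmod (Q rho)) (2 * sigma)) * Q rho = RtoC 0)%C).
Context (Q'0 : filterlim (fun h : R => (RtoC (/ h) * (Q h - Q 0))%C) (at_right 0)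
    (locally (RtoC 0))).

Let u r := fst (Q r). Let v r := snd (Q r).
Let u1 r := fst (Q1 r). Let v1 r := snd (Q1 r).
Let u2 r := fst (Q2 r). Let v2 r := snd (Q2 r).

Let Du r : 0 < r -> is_derive u r (u1 r). Proof. intros Hr; apply is_derive_fst, DQ, Hr. Qed.
Let Dv r : 0 < r -> is_derive v r (v1 r). Proof. intros Hr; apply is_derive_snd, DQ, Hr. Qed.
Let Du1 r : 0 < r -> is_derive u1 r (u2 r). Proof. intros Hr; apply is_derive_fst, DQ1, Hr. Qed.
Let Dv1 r : 0 < r -> is_derive v1 r (v2 r). Proof. intros Hr; apply is_derive_snd, DQ1, Hr. Qed.

Let Eu r : 0 < r -> u2 r = - (INR k / r) * u1 r + u r + a * (/ sigma * v r + r * v1 r)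
   - abspow sigma (u r ^ 2 + v r ^ 2) * u r.
Proof.
intros Hr. pose proof (f_equal fst (EQ r Hr)) as E. rewrite rpow_Cmod, S_INR in E.
unfold u, v, u1, v1, u2. simpl in E |- *.
replace ((INR k + 1 - 1) / r) with (INR k / r) in E by (field; lra). lra.
Qed.

Let Ev r : 0 < r -> v2 r = - (INR k / r) * v1 r + v r - a * (/ sigma * u r + r * u1 r)
   - abspow sigma (u r ^ 2 + v r ^ 2) * v r.
Proof.
intros Hr. pose proof (f_equal snd (EQ r Hr)) as E. rewrite rpow_Cmod, S_INR in E.
unfold u, v, u1, v1, v2. simpl in E |- *.
replace ((INR k + 1 - 1) / r) with (INR k / r) in E by (field; lra). lra.
Qed.

Let Lu : lim0 (fun h => (u h - u 0) / h) 0.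
Proof.
apply (filterlim_ext (fun h => fst (RtoC (/ h) * (Q h - Q 0))%C)).
  intros h; unfold u; simpl; unfold Rdiv; ring.
apply (filterlim_comp _ _ _ _ fst _ (locally (RtoC 0))); [exact Q'0|].
apply (continuous_fst (U := R_UniformSpace) (V := R_UniformSpace)).
Qed.

Let Lv : lim0 (fun h => (v h - v 0) / h) 0.
Proof.
apply (filterlim_ext (fun h => snd (RtoC (/ h) * (Q h - Q 0))%C)).
  intros h; unfold v; simpl; unfold Rdiv; ring.
apply (filterlim_comp _ _ _ _ snd _ (locally (RtoC 0))); [exact Q'0|].
apply (continuous_snd (U := R_UniformSpace) (V := R_UniformSpace)).
Qed.

Let m r := u r ^ 2 + v r ^ 2.

Let Lm : lim0 m (m 0).
Proof.
apply (lim0_ext (fun r => u r * u r + v r * v r) _ (u 0 * u 0 + v 0 * v 0)); [intros; unfold m;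
  ring|unfold m; ring|].
pose proof (lim0_of_quotient _ _ _ Lu). pose proof (lim0_of_quotient _ _ _ Lv).
apply lim0_plus; apply lim0_mult; assumption.
Qed.

Lemma profile_bounded_below : Q 0 <> RtoC 0 ->
  exists c r0, 0 < c /\ 0 < r0 /\ forall r, 0 <= r <= r0 -> c <= Cmod (Q r).
Proof.
intros HQ0.
assert (Hm0 : 0 < m 0).
  apply Cmod_gt_0 in HQ0. unfold Cmod in HQ0. apply Rnot_le_lt; intros Hle.
  rewrite sqrt_neg_0 in HQ0; [lra|exact Hle].
destruct (proj1 (lim0P _ _) Lm (m 0 / 2)) as [del [Hdel H]]; [lra|].
exists (sqrt (m 0 / 2)), (del / 2). split; [apply sqrt_lt_R0; lra|]. split; [lra|].
intros r [[Hr|<-] Hr2]; unfold Cmod; apply sqrt_le_1_alt.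
- specialize (H r ltac:(lra)). apply Rabs_def2 in H. unfold m, u, v in *. lra.
- unfold m, u, v in *. lra.
Qed.

Lemma profile_decay : exists K, 0 <= K /\
  forall r, 0 <= r -> Cmod (Q r) <= K * Rpower (1 + r) (- (INR (S k) - / sigma)).
Proof.
assert (Hb : forall r, 0 < r -> a ^ 2 * r ^ 2 * m r <= 4 * (u1 r ^ 2 + v1 r ^ 2)).
  exact (modulus_le_derivative k a sigma u v u1 v1 u2 v2 Ha Hsigma Hd Du Dv Du1 Dv1 Eu Ev Lu Lv).
destruct (modulus_decay k a sigma u v u1 v1 u2 v2 Ha Hsigma Hd Du Dv Du1 Dv1 Eu Ev Hb)
  as [K [R0 [HR0 [HK B]]]].
set (b := INR (S k) - / sigma) in *.
destruct (bounded_of_continuous m R0) as [M HM]; [lra| |exact Lm|].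
  intros r Hr. unfold m. pose proof (Du r Hr); pose proof (Dv r Hr).
  apply (ex_derive_continuous (fun r => u r ^ 2 + v r ^ 2)).
  auto_derive; repeat split; eexists; eassumption.
(* Chosen so that [w * Rpower (1 + r) (- b) >= 1] on [[0, R0]], where only the bound [sqrt M] is
   available. *)
set (w := Rpower (1 + R0) (Rabs b)).
exists (K + sqrt M * w).
assert (Hw : 0 < w) by apply Rpower_pos. pose proof (sqrt_pos M).
split; [nra|]. intros r Hr. pose proof (Rpower_pos (1 + r) (- b)).
change (Cmod (Q r)) with (sqrt (m r)).
destruct (Rle_lt_dec R0 r) as [H1|H1].
  specialize (B r H1). change (sqrt (m r) <= K * Rpower (1 + r) (- b)) in B.
  assert (0 <= sqrt M * w * Rpower (1 + r) (- b)) by (repeat apply Rmult_le_pos; lra). lra.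
assert (Hs : sqrt (m r) <= sqrt M) by (apply sqrt_le_1_alt, HM; lra).
assert (1 <= w * Rpower (1 + r) (- b)).
  unfold w, Rpower. rewrite <- exp_plus. apply Rle_trans with (exp 0); [rewrite exp_0; lra|].
  assert (0 <= ln (1 + r) <= ln (1 + R0)).
    split.
      destruct Hr as [Hr|<-]; [|rewrite Rplus_0_r, ln_1; lra].
      rewrite <- ln_1; left; apply ln_increasing; lra.
    left; apply ln_increasing; lra.
  assert (0 <= Rabs b * ln (1 + R0) + - b * ln (1 + r)).
    pose proof (Rle_abs b). pose proof (Rabs_pos b). nra.
  now apply exp_increasing_le.
nra.
Qed.

(** The limit of Q'(r) / r at 0, which is the second derivative of Q(|x|) at the origin along each
    single axis; the Laplacian there is d times this value. *)
Definition laplacian_origin : C :=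
  (((1 - abspow sigma (m 0)) * u 0 - a * (INR (S k) - / sigma) * v 0) / INR (S k) + a * v 0,
   ((1 - abspow sigma (m 0)) * v 0 + a * (INR (S k) - / sigma) * u 0) / INR (S k) - a * u 0).

Let radial_C (h1 h2 : R -> R) (L S w : R) : C :=
  (w / L ^ 2 * (h1 (sqrt (S + w ^ 2) / L) / (sqrt (S + w ^ 2) / L)),
   w / L ^ 2 * (h2 (sqrt (S + w ^ 2) / L) / (sqrt (S + w ^ 2) / L))).

Let radial_C_derive L S w : 0 < L -> 0 <= S ->
  is_derive (fun w => Q (sqrt (S + w ^ 2) / L)) w (radial_C u1 v1 L S w).
Proof.
intros HL HS. apply is_derive_C.
- exact (radial_derive u u1 L S Du Lu HL HS w).
- exact (radial_derive v v1 L S Dv Lv HL HS w).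
Qed.

Let second_partial_radial d (f : (fintype.ordinal d -> R) -> C) x (c : C) (L S : R) j (l : C) :
  0 < L -> 0 <= S ->
  (forall s, f (shift d x j s) = c * Q (sqrt (S + (x j + s) ^ 2) / L)%R)%C ->
  is_derive (radial_C u1 v1 L S) (x j) l ->
  second_partial d j f x (c * l)%C.
Proof.
intros HL HS Ef Hl.
exists (fun s => c * radial_C u1 v1 L S (x j + s))%C. split.
- exists (mkposreal 1 Rlt_0_1); intros s _.
  apply (is_derive_ext (fun s => c * Q (sqrt (S + (x j + s) ^ 2) / L)%R)%C).
    intros y; symmetry; apply Ef.
  apply is_derive_Cmult_l.
  apply (is_derive_translate_C (fun w => Q (sqrt (S + w ^ 2) / L))).
  now apply radial_C_derive.
- apply is_derive_Cmult_l, is_derive_translate_C. now rewrite Rplus_0_r.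
Qed.

Lemma profile_second_partial d (f : (fintype.ordinal d -> R) -> C) x (c : C) (L : R) j :
  0 < L -> (forall y, f y = c * Q (eucl_norm d y / L)%R)%C -> 0 < eucl_norm d x ->
  let rho := eucl_norm d x / L in
  second_partial d j f x
    (c * RtoC (/ L ^ 2) * (RtoC (/ rho) * Q1 rho)
     + RtoC (x j ^ 2) * (c * RtoC (/ L ^ 2) * RtoC (/ eucl_norm d x ^ 2) * (Q2 rho - RtoC (/ rho)
       * Q1 rho)))%C.
Proof.
intros HL Ef HN rho.
destruct (LpBounds.eucl_norm_shift x j) as [S [HS [Es E0]]].
assert (HP : 0 < S + x j ^ 2).
  apply Rnot_le_lt; intros Hle. rewrite E0, sqrt_neg_0 in HN by exact Hle. lra.
pose proof (radial_derive2 u1 u2 L S Du1 HL (x j) HP) as Hu.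
pose proof (radial_derive2 v1 v2 L S Dv1 HL (x j) HP) as Hv.
cbv beta in Hu, Hv. rewrite <- E0 in Hu, Hv. fold rho in Hu, Hv.
assert (HL2 : L ^ 2 * rho ^ 2 = eucl_norm d x ^ 2) by (unfold rho; field; lra).
rewrite HL2 in Hu, Hv.
assert (Hr : 0 < rho) by (apply Rdiv_lt_0_compat; lra).
set (l := (RtoC (/ L ^ 2) * (RtoC (/ rho) * Q1 rho) + RtoC (x j ^ 2) *
   (RtoC (/ L ^ 2) * RtoC (/ eucl_norm d x ^ 2) * (Q2 rho - RtoC (/ rho) * Q1 rho)))%C).
assert (Hl : is_derive (radial_C u1 v1 L S) (x j) l).
  apply is_derive_C.
  - evar_last; [exact Hu|]. unfold l, u1, u2, Rdiv; simpl. ring.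
  - evar_last; [exact Hv|]. unfold l, v1, v2, Rdiv; simpl. ring.
replace (c * RtoC (/ L ^ 2) * (RtoC (/ rho) * Q1 rho)
     + RtoC (x j ^ 2) * (c * RtoC (/ L ^ 2) * RtoC (/ eucl_norm d x ^ 2) * (Q2 rho - RtoC (/ rho)
       * Q1 rho)))%C
  with (c * l)%C by (unfold l; ring).
apply (second_partial_radial d f x c L S j l HL HS); [|exact Hl].
intros s. now rewrite Ef, Es.
Qed.

Lemma profile_second_partial_origin d (f : (fintype.ordinal d -> R) -> C) x (c : C) (L : R) j :
  0 < L -> (forall y, f y = c * Q (eucl_norm d y / L)%R)%C -> eucl_norm d x = 0 ->
  second_partial d j f x (c * (RtoC (/ L ^ 2) * laplacian_origin))%C.
Proof.
intros HL Ef HN.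
destruct (LpBounds.eucl_norm_shift x j) as [S [HS [Es E0]]].
rewrite HN in E0. symmetry in E0. pose proof (pow2_ge_0 (x j)).
apply sqrt_eq_0 in E0; [|lra].
assert (HS0 : S = 0) by lra.
assert (Hx : x j = 0) by nra.
apply (second_partial_radial d f x c L S j); [exact HL|exact HS| |].
  intros s. now rewrite Ef, Es.
rewrite Hx. apply is_derive_C.
- evar_last.
    exact (radial_derive2_origin u1 _ L S
      (profile_origin_re k a sigma u v u1 v1 u2 Hsigma Du Dv Du1 Eu Lu Lv) HL HS0).
  unfold laplacian_origin, m; cbn [fst snd Cmult RtoC]; ring.
- evar_last.
    exact (radial_derive2_origin v1 _ L S
      (profile_origin_im k a sigma u v u1 v1 v2 Hsigma Du Dv Dv1 Ev Lu Lv) HL HS0).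
  unfold laplacian_origin, m; cbn [fst snd Cmult RtoC]; ring.
Qed.

Context (Tc : R) (HTc : 0 < Tc).

Let phase t : C := (cos (tau_ a Tc t), sin (tau_ a Tc t)).
Let coef t : C := (RtoC (/ Rpower (L_ a Tc t) (/ sigma)) * phase t)%C.

Let scaled_derive (h h1 : R -> R) N t : 0 <= N -> t < Tc ->
  (forall r, 0 < r -> is_derive h r (h1 r)) ->
  is_derive (fun s => h (N / L_ a Tc s)) t (a / L_ a Tc t ^ 2 * (N / L_ a Tc t) * h1 (N / L_ a Tc
    t)).
Proof.
intros HN Ht Dh. pose proof (L_pos a Tc Ha t Ht) as HL.
destruct HN as [HN|<-].
- pose proof (is_derive_L a Tc Ha t Ht) as DL.
  assert (Hr : 0 < N / L_ a Tc t) by (apply Rdiv_lt_0_compat; lra).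
  evar_last.
    apply (is_derive_comp h (fun s => N / L_ a Tc s)); [apply Dh, Hr|].
    set (l := L_ a Tc) in *.
    auto_derive; [repeat split; [eexists; eassumption|lra]|]. derive_unique. reflexivity.
  unfold scal; simpl; unfold mult; simpl. field. lra.
(* At x = 0 the argument of [h] stays 0 at all times, and the factor [0 / L_ a Tc t] kills the
   uncontrolled value [h1 0]. *)
- apply (is_derive_ext (fun _ => h 0)).
    intros s; unfold Rdiv; now rewrite Rmult_0_l.
  replace (a / L_ a Tc t ^ 2 * (0 / L_ a Tc t) * h1 (0 / L_ a Tc t)) with 0 by (unfold Rdiv; ring).
  apply (is_derive_const (h 0)).
Qed.

(** The factor [coef t / L^2] is pulled out because the Laplacian and the nonlinear term carry it
    too; what remains of the equation is the profile equation at [rho]. *)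
Lemma psi_explicit_time_derive d (x : fintype.ordinal d -> R) t : t < Tc ->
  let rho := eucl_norm d x / L_ a Tc t in
  is_derive (fun s => psi_explicit d sigma a Tc Q s x) t
    (coef t * RtoC (/ L_ a Tc t ^ 2) *
      (RtoC (a / sigma) * Q rho + RtoC (a * rho) * Q1 rho + Ci * Q rho))%C.
Proof.
intros Ht rho. pose proof (L_pos a Tc Ha t Ht) as HL.
assert (HN : 0 <= eucl_norm d x) by apply sqrt_pos.
pose proof (scaled_derive u u1 _ t HN Ht Du) as DU.
pose proof (scaled_derive v v1 _ t HN Ht Dv) as DV.
pose proof (is_derive_amplitude a Tc Ha (/ sigma) t Ht) as DA.
pose proof (is_derive_tau a Tc Ha t HTc Ht) as DT.
fold rho in DU, DV.
set (U := fun s => u (eucl_norm d x / L_ a Tc s)) in *.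
set (V := fun s => v (eucl_norm d x / L_ a Tc s)) in *.
set (A := fun t => / Rpower (L_ a Tc t) (/ sigma)) in *.
set (T := tau_ a Tc) in *.
apply is_derive_C.
- apply (is_derive_ext (fun s => A s * (U s * cos (T s) - V s * sin (T s)))).
    intros s; unfold A, U, V, T, u, v, psi_explicit; simpl; ring.
  evar_last.
    auto_derive; [repeat split; eexists; eassumption|reflexivity].
  derive_unique. unfold coef, phase. fold T. change (/ Rpower (L_ a Tc t) (/ sigma)) with (A t).
  unfold U, V. fold rho. unfold u1, v1, u, v; simpl. field. split; lra.
- apply (is_derive_ext (fun s => A s * (U s * sin (T s) + V s * cos (T s)))).
    intros s; unfold A, U, V, T, u, v, psi_explicit; simpl; ring.
  evar_last.
    auto_derive; [repeat split; eexists; eassumption|reflexivity].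
  derive_unique. unfold coef, phase. fold T. change (/ Rpower (L_ a Tc t) (/ sigma)) with (A t).
  unfold U, V. fold rho. unfold u1, v1, u, v; simpl. field. split; lra.
Qed.

Lemma Cmod_phase t : Cmod (phase t) = 1.
Proof.
unfold Cmod, phase; cbn [fst snd]. rewrite <- sqrt_1. f_equal.
pose proof (sin2_cos2 (tau_ a Tc t)) as H. unfold Rsqr in H. simpl. lra.
Qed.

Lemma Cmod_psi_explicit d t (x : fintype.ordinal d -> R) :
  Cmod (psi_explicit d sigma a Tc Q t x) =
  / Rpower (L_ a Tc t) (/ sigma) * Cmod (Q (eucl_norm d x / L_ a Tc t)).
Proof.
unfold psi_explicit. fold (phase t). rewrite !Cmod_mult, Cmod_phase, Cmod_R, Rmult_1_r.
f_equal. apply Rabs_pos_eq. left; apply Rinv_0_lt_compat, Rpower_pos.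
Qed.

Lemma rpow_Cmod_psi_explicit d t (x : fintype.ordinal d -> R) : t < Tc ->
  rpow (Cmod (psi_explicit d sigma a Tc Q t x)) (2 * sigma) =
  / L_ a Tc t ^ 2 * rpow (Cmod (Q (eucl_norm d x / L_ a Tc t))) (2 * sigma).
Proof.
intros Ht. pose proof (L_pos a Tc Ha t Ht) as HL.
rewrite Cmod_psi_explicit, rpow_mult; [|apply Rinv_0_lt_compat, Rpower_pos|apply Cmod_ge_0].
f_equal. rewrite <- Rpower_Ropp, Rpower_mult.
replace (- / sigma * (2 * sigma)) with (- (INR 2)) by (simpl; field; lra).
now rewrite Rpower_Ropp, Rpower_pow.
Qed.

Lemma psi_explicit_solves t (x : fintype.ordinal (S k) -> R) : t < Tc ->
  exists psit lap : C,
    is_derive (fun s => psi_explicit (S k) sigma a Tc Q s x) t psit /\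
    laplacian_is (S k) (psi_explicit (S k) sigma a Tc Q t) x lap /\
    (Ci * psit + lap + RtoC (rpow (Cmod (psi_explicit (S k) sigma a Tc Q t x)) (2 * sigma))
       * psi_explicit (S k) sigma a Tc Q t x = RtoC 0)%C.
Proof.
intros Ht. pose proof (L_pos a Tc Ha t Ht) as HL.
pose proof (psi_explicit_time_derive (S k) x t Ht) as DT; cbv zeta in DT.
set (L := L_ a Tc t) in *. set (N := eucl_norm (S k) x) in *.
assert (HN : 0 <= N) by apply sqrt_pos.
assert (Epsi : forall y, psi_explicit (S k) sigma a Tc Q t y = (coef t * Q (eucl_norm (S k) y /
  L)%R)%C).
  intros y; unfold psi_explicit, coef, phase, L; ring.
set (iL2 := / L ^ 2) in *.
assert (HD : INR (S k) <> 0) by (apply not_0_INR; lia).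
rewrite rpow_Cmod_psi_explicit, Epsi by exact Ht. fold L N iL2.
destruct HN as [HN|HN].
- set (rho := N / L) in *. assert (Hr : 0 < rho) by (apply Rdiv_lt_0_compat; lra).
  eexists; exists (coef t * RtoC iL2 * (Q2 rho + RtoC (INR k / rho) * Q1 rho))%C.
  split; [exact DT|]. split.
  + eexists; split.
      intros j. apply (profile_second_partial (S k) _ x (coef t) L j HL Epsi HN).
    cbv beta; rewrite LpBounds.Csum_affine_sq. fold N rho iL2.
    set (c := coef t). destruct c as [c1 c2]. rewrite S_INR.
    apply injective_projections; simpl; field; split; lra.
  + pose proof (EQ rho Hr) as E. set (w := rpow _ _) in *.
    replace ((INR (S k) - 1) / rho) with (INR k / rho) in E by (rewrite S_INR; field; lra).
    transitivity (coef t * RtoC iL2 * RtoC 0)%C; [|ring]. rewrite <- E.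
    set (c := coef t). destruct c as [c1 c2].
    apply injective_projections; simpl; field; lra.
(* At x = 0 the profile equation is replaced by its limit: q = [laplacian_origin] satisfies d q -
   Q(0) + i a Q(0) / sigma + |Q(0)|^(2 sigma) Q(0) = 0. *)
- symmetry in HN. eexists; exists (RtoC (INR (S k)) * (coef t * (RtoC iL2 * laplacian_origin)))%C.
  split; [exact DT|]. split.
  + exists (fun j => coef t * (RtoC iL2 * laplacian_origin) + RtoC (x j ^ 2) * RtoC 0)%C; split.
      intros j. rewrite Cmult_0_r, Cplus_0_r.
      exact (profile_second_partial_origin (S k) _ x (coef t) L j HL Epsi HN).
    cbv beta; rewrite LpBounds.Csum_affine_sq. ring.
  + rewrite HN. replace (0 / L) with 0 by (field; lra). rewrite rpow_Cmod.
    unfold laplacian_origin. fold (u 0) (v 0). fold (m 0).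
    set (w := abspow _ _). set (D := INR (S k)) in *.
    set (c := coef t). destruct c as [c1 c2]. unfold u, v.
    apply injective_projections; simpl; field; lra.
Qed.

End complex_profile.

(** * Blow-up rate and rescaling of the bounds *)

Lemma Rpower_L_blowup (a Tc c gamma M : R) : 0 < a -> 0 < c -> 0 < gamma ->
  exists delta, 0 < delta /\
    forall t, Tc - delta < t < Tc -> M < c * Rpower (L_ a Tc t) (- gamma).
Proof.
intros Ha Hc Hg.
set (X := (Rabs M + 1) / c).
assert (HX : 0 < X) by (apply Rdiv_lt_0_compat; [pose proof (Rabs_pos M); lra|exact Hc]).
(* [eta] solves eta^(- gamma) = X with c X = |M| + 1, and L < eta as soon as Tc - t < eta^2 / (2
   a). *)
set (eta := Rpower X (- / gamma)). assert (He : 0 < eta) by apply Rpower_pos.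
exists (eta ^ 2 / (2 * a)). split; [apply Rdiv_lt_0_compat; [apply pow_lt|]; lra|].
intros t Ht.
assert (HL : 0 < L_ a Tc t) by (apply L_pos; lra).
assert (HLe : L_ a Tc t < eta).
  unfold L_. rewrite <- (sqrt_pow2 eta) by lra. apply sqrt_lt_1_alt. split; [nra|].
  replace (eta ^ 2) with (2 * a * (eta ^ 2 / (2 * a))) by (field; lra).
  apply Rmult_lt_compat_l; lra.
assert (HP : Rpower (L_ a Tc t) gamma < / X).
  replace (/ X) with (Rpower eta gamma).
    apply Rlt_Rpower_l; lra.
  unfold eta. rewrite Rpower_mult. replace (- / gamma * gamma) with (- (1)) by (field; lra).
  now rewrite Rpower_Ropp, Rpower_1.
rewrite Rpower_Ropp.
assert (X < / Rpower (L_ a Tc t) gamma).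
  rewrite <- (Rinv_inv X). apply Rinv_lt_contravar; [|exact HP].
  apply Rmult_lt_0_compat; [apply Rpower_pos|now apply Rinv_0_lt_compat].
apply Rle_lt_trans with (c * X); [|now apply Rmult_lt_compat_l].
replace (c * X) with (Rabs M + 1) by (unfold X; field; lra).
pose proof (Rle_abs M); lra.
Qed.

(** From 1 + N <= (1 + L) (1 + N / L). It turns decay in rho into decay in |x| at fixed time, with a
    constant depending on L. *)
Lemma decay_rescale (K b L N : R) : 0 <= K -> 0 < b -> 0 < L -> 0 <= N ->
  K * Rpower (1 + N / L) (- b) <= K * Rpower (1 + L) b * Rpower (1 + N) (- b).
Proof.
intros HK Hb HL HN. rewrite Rmult_assoc. apply Rmult_le_compat_l; [exact HK|].
assert (HNL : 0 <= N / L) by (apply Rdiv_le_0_compat; lra).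
unfold Rpower. rewrite <- exp_plus. apply exp_increasing_le.
assert (Hln : ln (1 + N) <= ln ((1 + L) * (1 + N / L))).
  assert (Hle : 1 + N <= (1 + L) * (1 + N / L)).
    replace ((1 + L) * (1 + N / L)) with (1 + N + L + N / L) by (field; lra). lra.
  destruct Hle as [Hlt| ->]; [left; apply ln_increasing; lra|lra].
rewrite ln_mult in Hln by lra. nra.
Qed.

Lemma Rpower_amplitude_merge (c L r0 D s r : R) : 0 < L -> 0 < r0 -> 0 < D -> 0 < s -> 0 < r ->
  / Rpower L (/ s) * c * Rpower (r0 * L / D) (D / r) =
  c * Rpower (r0 / D) (D / r) * Rpower L (- (/ s - D / r)).
Proof.
intros HL Hr0 HD Hs Hr.
replace (r0 * L / D) with (r0 / D * L) by (field; lra).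
rewrite <- Rpower_mult_distr by (try apply Rdiv_lt_0_compat; lra).
rewrite <- Rpower_Ropp. replace (- (/ s - D / r)) with (- / s + D / r) by ring.
rewrite Rpower_plus. ring.
Qed.

Theorem theorem3 (d : nat) (sigma a Tc : R) (p : Rbar) (Q Q1 Q2 : R -> C) :
  (1 <= d)%nat ->
  0 < sigma ->
  1 < sigma * INR d < 2 ->
  (* p^* < p <= +oo,  p^* = sigma d / (sigma d - 1) *)
  Rbar_lt (sigma * INR d / (sigma * INR d - 1)) p ->
  0 < a ->
  (* Q solves the ODE on (0, oo), with Q1 = Q', Q2 = Q'' *)
  (forall rho, 0 < rho -> is_derive Q rho (Q1 rho)) ->
  (forall rho, 0 < rho -> is_derive Q1 rho (Q2 rho)) ->
  (forall rho, 0 < rho ->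
     (Q2 rho + RtoC ((INR d - 1) / rho) * Q1 rho - Q rho
      + Ci * RtoC a * (RtoC (/ sigma) * Q rho + RtoC rho * Q1 rho)
      + RtoC (rpow (Cmod (Q rho)) (2 * sigma)) * Q rho = RtoC 0)%C) ->
  (* Q(0) <> 0 and Q'(0) = 0 (one-sided derivative at rho = 0) *)
  Q 0 <> RtoC 0 ->
  filterlim (fun h : R => (RtoC (/ h) * (Q h - Q 0))%C) (at_right 0)
    (locally (RtoC 0)) ->
  0 < Tc ->
  let psi := psi_explicit d sigma a Tc Q in
  (* psi solves  i psi_t + Delta psi + |psi|^(2 sigma) psi = 0  on [0,Tc) x R^d *)
  (forall t x, 0 <= t < Tc ->
     exists psit lap : C,
       is_derive (fun s => psi s x) t psit /\
       laplacian_is d (psi t) x lap /\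
       (Ci * psit + lap + RtoC (rpow (Cmod (psi t x)) (2 * sigma)) * psi t x
        = RtoC 0)%C) /\
  (* ||psi(t)||_p < oo for 0 <= t < Tc *)
  (forall t, 0 <= t < Tc -> Rbar_lt (Lpnorm d p (psi t)) p_infty) /\
  (* ||psi(t)||_p -> oo as t -> Tc *)
  (forall M : R, exists delta, 0 < delta /\
     forall t, Tc - delta < t < Tc -> Rbar_lt M (Lpnorm d p (psi t))).
Proof.
intros Hd Hs [Hsd1 Hsd2] Hp Ha DQ DQ1 EQ HQ0 Q'0 HTc psi.
destruct d as [|k]; [lia|].
set (D := INR (S k)) in *.
assert (HD : 0 < D) by (apply lt_0_INR; lia).
set (b := D - / sigma).
assert (Hb : 0 < b).
  unfold b. apply Rmult_lt_reg_l with (1 := Hs).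
    rewrite Rmult_0_r, Rmult_minus_distr_l, Rinv_r; lra.
destruct (profile_decay k sigma a Q Q1 Q2 Hs Ha Hsd2 DQ DQ1 EQ Q'0) as [K [HK Hdecay]].
destruct (profile_bounded_below Q Q'0 HQ0) as [c [r0 [Hc [Hr0 Hlow]]]].
assert (Hup : forall t, t < Tc -> forall x, Cmod (psi t x) <=
    / Rpower (L_ a Tc t) (/ sigma) * (K * Rpower (1 + L_ a Tc t) b) * Rpower (1 +
      eucl_norm (S k) x) (- b)).
  intros t Ht x. pose proof (L_pos a Tc Ha t Ht) as HL.
  assert (HN : 0 <= eucl_norm (S k) x) by apply sqrt_pos.
  unfold psi. rewrite Cmod_psi_explicit, Rmult_assoc. apply Rmult_le_compat_l.
    left; apply Rinv_0_lt_compat, Rpower_pos.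
  eapply Rle_trans; [apply Hdecay, Rdiv_le_0_compat; lra|]. now apply decay_rescale.
(* The side [r0 * L / D] keeps the cube inside the ball |x| <= r0 L, where the profile is at least
   [c] in modulus. *)
assert (Hdown : forall t, t < Tc -> forall x, (forall j, 0 <= x j <= r0 * L_ a Tc t / D) ->
    / Rpower (L_ a Tc t) (/ sigma) * c <= Cmod (psi t x)).
  intros t Ht x Hx. pose proof (L_pos a Tc Ha t Ht) as HL.
  assert (HN : 0 <= eucl_norm (S k) x) by apply sqrt_pos.
  unfold psi. rewrite Cmod_psi_explicit. apply Rmult_le_compat_l.
    left; apply Rinv_0_lt_compat, Rpower_pos.
  apply Hlow. split; [apply Rdiv_le_0_compat; lra|].
  pose proof (LpBounds.eucl_norm_cube_le Hx) as Hle. fold D in Hle.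
  replace (D * (r0 * L_ a Tc t / D)) with (r0 * L_ a Tc t) in Hle by (field; lra).
  apply Rmult_le_reg_r with (1 := HL). unfold Rdiv; rewrite Rmult_assoc, Rinv_l; lra.
assert (Hl : forall t, t < Tc -> 0 < r0 * L_ a Tc t / D).
  intros t Ht. pose proof (L_pos a Tc Ha t Ht). apply Rdiv_lt_0_compat; [nra|exact HD].
split; [|split].
- intros t x Ht. apply (psi_explicit_solves k sigma a Q Q1 Q2); try assumption; lra.
- intros t [_ Ht].
  set (K' := / Rpower (L_ a Tc t) (/ sigma) * (K * Rpower (1 + L_ a Tc t) b)).
  assert (HK' : 0 <= K').
    apply Rmult_le_pos; [left; apply Rinv_0_lt_compat, Rpower_pos|].
    apply Rmult_le_pos; [exact HK|left; apply Rpower_pos].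
  destruct p as [r| |]; [| |destruct Hp].
  + simpl in Hp.
    assert (Hr : 0 < r).
      eapply Rlt_trans; [|exact Hp]. apply Rdiv_lt_0_compat; lra.
    apply (LpBounds.Lpnorm_lt_pinfty (b := b) (K := K') Hr); [|exact HK'|exact (Hup t Ht)].
    fold D. unfold b. apply (Rmult_lt_compat_r (sigma * D - 1)) in Hp; [|lra].
    unfold Rdiv in Hp. rewrite Rmult_assoc, Rinv_l, Rmult_1_r in Hp by lra.
    apply Rmult_lt_reg_l with (1 := Hs).
    replace (sigma * ((D - / sigma) * r)) with (r * (sigma * D - 1)) by (field; lra). exact Hp.
  + apply (LpBounds.Linftynorm_lt_pinfty (K := K')). intros x.
    eapply Rle_trans; [apply (Hup t Ht)|]. fold K'.
    assert (HN : 0 <= eucl_norm (S k) x) by apply sqrt_pos.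
    rewrite <- (Rmult_1_r K') at 2. apply Rmult_le_compat_l; [exact HK'|].
    unfold Rpower. apply Rle_trans with (exp 0); [apply exp_increasing_le|rewrite exp_0; lra].
    assert (0 <= ln (1 + eucl_norm (S k) x)).
      destruct HN as [HN|<-]; [|rewrite Rplus_0_r, ln_1; lra].
      rewrite <- ln_1; left; apply ln_increasing; lra.
    nra.
- intros M. destruct p as [r| |]; [| |destruct Hp].
  + simpl in Hp.
    (* p^* = sigma d / (sigma d - 1) exceeds sigma d because 0 < sigma d - 1 < 1; this makes the
       exponent 1/sigma - d/p positive. *)
    assert (Hr : sigma * D < r).
      eapply Rlt_trans; [|exact Hp]. apply Rmult_lt_reg_r with (sigma * D - 1); [lra|].
      replace (sigma * D / (sigma * D - 1) * (sigma * D - 1)) with (sigma * D) by (field; lra). nra.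
    assert (Hr0' : 0 < r) by nra.
    assert (Hg : 0 < / sigma - D / r).
      apply Rmult_lt_reg_l with (sigma * r); [nra|].
      replace (sigma * r * (/ sigma - D / r)) with (r - sigma * D) by (field; lra). lra.
    destruct (Rpower_L_blowup a Tc (c * Rpower (r0 / D) (D / r)) (/ sigma - D / r) M Ha) as [del
      [Hdel H]];
      [apply Rmult_lt_0_compat; [exact Hc|apply Rpower_pos]|exact Hg|].
    exists del; split; [exact Hdel|]. intros t Ht. specialize (H t Ht).
    rewrite <- Rpower_amplitude_merge in H by (try apply L_pos; lra).
    refine (Rbar_lt_le_trans (Finite M) (Finite _) _ H _).
    apply LpBounds.Lpnorm_cube_ge; [exact Hr0'|apply Hl; lra| |apply Hdown; lra].
    apply Rmult_le_pos; [left; apply Rinv_0_lt_compat, Rpower_pos|lra].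
  + destruct (Rpower_L_blowup a Tc c (/ sigma) M Ha Hc) as [del [Hdel H]];
    [now apply Rinv_0_lt_compat|].
    exists del; split; [exact Hdel|]. intros t Ht. specialize (H t Ht).
    rewrite Rpower_Ropp, Rmult_comm in H.
    refine (Rbar_lt_le_trans (Finite M) (Finite _) _ H _).
    apply (LpBounds.Linftynorm_cube_ge (l := r0 * L_ a Tc t / D)); [apply Hl; lra|apply Hdown; lra].
Qed.
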